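(* Let $p$ be a prime and $K$ an algebraically closed field of characteristic $p$. The completion (closure in $K((t^{\mathbb{Q}}))$ for the $t$-adic topology) of the integral closure of $K(t)$ in $K((t^{\mathbb{Q}}))$ — which equals that of the integral closure of $K((t))$ — consists of exactly those $x\in K((t^{\mathbb{Q}}))$ all of whose truncations are $p$-quasi-automatic.
   Context: $K((t^{\mathbb{Q}}))$ is the field of generalized (Hahn) power series $x=\sum_{i\in\mathbb{Q}}x_it^i$ with $x_i\in K$ and well-ordered support; its $t$-adic valuation is $v(x)=\min\{i:x_i\neq0\}$. For $r\in\mathbb{R}$, the $r$-truncation of $x$ is $\sum_{i<r}x_it^i$; a truncation of $x$ is an $r$-truncation for some $r\in\mathbb{R}$. $\varphi$ denotes the Frobenius $x\mapsto x^p$ on $K$. Strings: $\Sigma_p=\{0,\dots,p-1\}$; $\Sigma_p^*$ the finite words over $\Sigma_p$; $\mathrm{rev}$ word reversal; $L_p^0$ the words not beginning with $0$; $L_p$ the words $s_1.s_2$ over $\Sigma_p\cup\{.\}$ with $s_1\in L_p^0$, $s_2\in\mathrm{rev}(L_p^0)$, and $\|s_1.s_2\|$ the rational number with base-$p$ integer digits $s_1$ and fractional digits $s_2$ (a bijection $L_p\to\mathbb{Z}[p^{-1}]_{\ge0}$). For a finite-dimensional $K$-vector space $V$ and an automorphism $\psi$ of $K$, an additive $g:V\to V$ is $\psi$-semilinear if $g(rv)=\psi(r)g(v)$; $f:\Sigma_p^*\to\mathrm{End}_{\mathbb{Z}}(V)$ is $\psi$-composed if $f(a_1\cdots a_n)=\tau(a_1)\circ\cdots\circ\tau(a_n)$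 for some map $\tau$ from $\Sigma_p$ to $\psi$-semilinear endomorphisms (with $f(\emptyset)=\mathrm{id}$). $f:L_p\to\mathrm{End}_{\mathbb{Z}}(V)$ is $\varphi$-biautomatic if there exist a finite-dimensional $V'$, a $K$-linear injection $\iota:V\to V'$, a $K$-linear surjection $\pi:V'\to V$, a $\varphi$-composed $f_1$ and a $\varphi^{-1}$-composed $f_2$ with values in $\mathrm{End}_{\mathbb{Z}}(V')$ such that $f(s_1.s_2)=\pi\circ f_1(\mathrm{rev}(s_1))\circ f_2(s_2)\circ\iota$. $x$ is $p$-automatic if its support lies in $\mathbb{Z}[p^{-1}]_{\ge0}$ and $x_{\|s\|}=f(s)(1)$ for all $s\in L_p$ for some $\varphi$-biautomatic $f:L_p\to\mathrm{End}_{\mathbb{Z}}(K)$. $x$ is $p$-quasi-automatic if for some integers $a>0,b\ge0$ its support is contained in $\{(i-b)/a:i\in\mathbb{Z}[p^{-1}]_{\ge0}\}$ and $\sum_ix_it^{ai+b}$ is $p$-automatic. *)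

(* Defs.v *)
From HB Require Import structures.
From mathcomp Require Import all_boot all_order all_algebra.
From mathcomp Require Import boolp classical_sets fsbigop reals.
Set Implicit Arguments. Unset Strict Implicit. Unset Printing Implicit Defensive.
Import Order.TTheory GRing.Theory Num.Theory.
Local Open Scope ring_scope.
Local Open Scope classical_set_scope.

Section Hahn.
Variable K : closedFieldType.

(* A generalized power series x = sum_{i in Q} x_i t^i is represented by its
   coefficient function rat -> K; it belongs to K((t^Q)) iff its support is
   well-ordered (every nonempty subset of the support has a least element). *)
Definition hahn (x : rat -> K) : Prop :=
  forall S : rat -> Prop, (forall i, S i -> x i != 0) -> (exists i, S i) ->
    exists i, S i /\ forall j, S j -> (i <= j)%R.

Definition hzero : rat -> K := fun _ => 0.
Definition hone : rat -> K := fun i => if i == 0 then 1 else 0.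
Definition hadd (x y : rat -> K) : rat -> K := fun i => x i + y i.
(* Cauchy product; for Hahn series the sum has finite support. *)
Definition hmul (x y : rat -> K) : rat -> K :=
  fun k => \sum_(i \in [set: rat]) x i * y (k - i).
Definition hexp (x : rat -> K) (n : nat) : rat -> K := iter n (hmul x) hone.

Definition polyH (f : {poly K}) : rat -> K :=
  fun i => if (0 <= i) && (i \is a Num.int) then f`_(`|numq i|%N) else 0.

Definition Kt (a : rat -> K) : Prop :=
  exists f g : {poly K}, g != 0 /\ hmul a (polyH g) = polyH f.

Definition Klaurent (a : rat -> K) : Prop :=
  forall i, a i != 0 -> i \is a Num.int.

Definition integral_over (S : (rat -> K) -> Prop) (x : rat -> K) : Prop :=
  hahn x /\ exists (n : nat) (a : 'I_n -> rat -> K),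
    (forall k, hahn (a k) /\ S (a k)) /\
    \big[hadd/hzero]_(k < n) hmul (a k) (hexp x k) = (fun i => - hexp x n i).

Definition tclosure (S : (rat -> K) -> Prop) (x : rat -> K) : Prop :=
  hahn x /\ forall r : rat, exists y, hahn y /\ S y /\
    forall i, (i <= r)%R -> x i = y i.

Definition trunc (R : realType) (x : rat -> K) (r : R) : rat -> K :=
  fun i => if (ratr i < r)%R then x i else 0.

Variable p : nat.

Definition composed (V : Type) (tau : 'I_p -> V -> V) (w : seq 'I_p) : V -> V :=
  foldr (fun a g => tau a \o g) id w.

Definition Lp0 (w : seq 'I_p) : bool :=
  if w is a :: _ then nat_of_ord a != 0%N else true.

(* L_p : words s1.s2 with s1 in L_p^0 and s2 in rev(L_p^0) *)
Definition Lp (s : seq 'I_p * seq 'I_p) : bool := Lp0 s.1 && Lp0 (rev s.2).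

Definition Lval (s : seq 'I_p * seq 'I_p) : rat :=
  foldl (fun acc (a : 'I_p) => acc * p%:R + (nat_of_ord a)%:R) 0 s.1 +
  foldr (fun (a : 'I_p) acc => ((nat_of_ord a)%:R + acc) / p%:R) 0 s.2.

Definition ZpinvNonneg (i : rat) : Prop :=
  (0 <= i)%R /\ exists k : nat, (denq i %| (p ^ k)%:Z)%Z.

Definition semilinear (m : nat) (psi : K -> K) (g : 'rV[K]_m -> 'rV[K]_m) : Prop :=
  (forall u v, g (u + v) = g u + g v) /\ (forall r v, g (r *: v) = psi r *: g v).

Definition frob (r : K) : K := r ^+ p.

(* x is p-automatic: support in Z[1/p]_{>=0} and x_{||s||} = f(s)(1) for a
   phi-biautomatic f : L_p -> End_Z(K). *)
Definition p_automatic (x : rat -> K) : Prop :=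
  (forall i, x i != 0 -> ZpinvNonneg i) /\
  exists (m : nat) (iota : K -> 'rV[K]_m) (pi : 'rV[K]_m -> K)
         (tau1 tau2 : 'I_p -> 'rV[K]_m -> 'rV[K]_m) (frobinv : K -> K),
    [/\ cancel frobinv frob /\ cancel frob frobinv,
        (forall a u v : K, iota (a * u + v) = a *: iota u + iota v) /\ injective iota,
        (forall (a : K) u v, pi (a *: u + v) = a * pi u + pi v) /\
           (forall c : K, exists v, pi v = c),
        (forall a, semilinear frob (tau1 a)) /\ (forall a, semilinear frobinv (tau2 a)) &
        forall s, Lp s ->
          x (Lval s) = pi (composed tau1 (rev s.1) (composed tau2 s.2 (iota 1)))].

Definition p_quasi_automatic (x : rat -> K) : Prop :=
  exists (a b : nat), (0 < a)%N /\
    (forall i, x i != 0 -> exists j, ZpinvNonneg j /\ i = (j - b%:R) / a%:R) /\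
    p_automatic (fun j => x ((j - b%:R) / a%:R)).

End Hahn.

(* Main.v *)
Require Import Defs.
From HB Require Import structures.
From mathcomp Require Import all_boot all_order all_algebra.
From mathcomp Require Import boolp classical_sets fsbigop reals.
From mathcomp Require Import ring lra zify.
Set Implicit Arguments. Unset Strict Implicit. Unset Printing Implicit Defensive.
Import Order.TTheory GRing.Theory Num.Theory.
Local Open Scope ring_scope.

(* From automata to algebraicity: the coordinates of the states reached by the
   fractional digits, raised to p-powers, form a finite family of functions on
   [0,1) whose Frobenius images are combinations of integer translates of the
   family. Hence, for x with bounded support, all x^(p^j) lie in one finitely
   generated K[t]-module and a nontrivial relation sum_j c_j x^(p^j) = 0 holds
   over K[t]. Well-orderedness of the state functions is never needed.

   From algebraicity to automata: x integral over K((t)) satisfies a nontrivial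
   relation sum_j c_j x^(p^j) = 0 over K((t)). After extraction of p-th roots
   c_0 is nonzero; the first slope of the Newton polygon and Hensel's lemma give
   a nonzero Puiseux root w. With x = w y the relation becomes one of smaller
   order for y^p - y, so everything reduces to Artin-Schreier equations. The
   class propagated along this induction consists of the series whose
   restriction to every bounded initial segment of Q lies in a finitely
   generated Frobenius-stable K[t^Q]-module of functions with bounded support;
   reading off base-p digits turns such a module into an automaton. *)

(** * Hahn series *)

(** Truncations of an integral series are not visibly integral, so truncation has to be built into
    the class propagated along the induction: this is why that class speaks of all bounded initial
    segments. Below a fixed bound only finitely many exponents of a Puiseux factor matter, which
    makes the class stable under multiplication by Puiseux series. A root y of y^p = y + z is
    adjoined as one new generator, so finiteness is free; the work lies in controlling the support
    of y and its denominators, and negative and positive exponents need different arguments.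

    On the side of automata, fractional digits act by inverse Frobenius and integer digits by
    Frobenius. The value x_{n+f} is thus p^l-semilinear in the state reached by f, with l the number
    of digits of n, and a bound on the support leaves finitely many l. Hence one copy of the state
    space for each l in both directions: p^l-th powers when starting from an automaton, p^l-th roots
    when building one. *)

Definition wo (P : rat -> Prop) : Prop :=
  forall S : rat -> Prop, (forall i, S i -> P i) -> (exists i, S i) ->
    exists i, S i /\ forall j, S j -> i <= j.

Lemma wo_sub (P Q : rat -> Prop) : (forall i, Q i -> P i) -> wo P -> wo Q.
Proof. by move=> QP woP S SQ; apply: woP => i /SQ /QP. Qed.

Lemma wo_union (A B : rat -> Prop) : wo A -> wo B -> wo (fun i => A i \/ B i).
Proof.
move=> wA wB S SAB [i0 Si0].
have [[i [Si Ai]]|noA] := pselect (exists i, S i /\ A i); last first.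
  apply: wB; last by exists i0.
  by move=> i Si; case: (SAB i Si) => // Ai; case: noA; exists i.
have [a [[Sa Aa] mina]] : exists a, (S a /\ A a) /\ forall j, S j /\ A j -> a <= j.
  by apply: wA => [j []//|]; exists i.
have [[j [Sj Bj]]|noB] := pselect (exists i, S i /\ B i); last first.
  exists a; split=> // j Sj; apply: mina; split=> //.
  by case: (SAB j Sj) => // Bj; case: noB; exists j.
have [b [[Sb Bb] minb]] : exists a, (S a /\ B a) /\ forall j, S j /\ B j -> a <= j.
  by apply: wB => [k []//|]; exists j.
have [ab|ba] := lerP a b.
  exists a; split=> // k Sk; case: (SAB k Sk) => ?; first exact: mina.
  by apply: le_trans ab _; apply: minb.
exists b; split=> // k Sk; case: (SAB k Sk) => ?; last exact: minb.
by apply: le_trans (ltW ba) _; apply: mina.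
Qed.

(* A pair (a, b) such that no pair with a smaller or equal sum has a smaller
   first component exists below every sum; among these, the one with the least
   second component realizes the least sum. *)
Lemma wo_add (A B : rat -> Prop) : wo A -> wo B ->
  wo (fun k => exists i j, [/\ A i, B j & k = i + j]).
Proof.
move=> wA wB S SAB [s0 Ss0].
pose T a b := [/\ A a, B b, S (a + b) & forall a' b', A a' -> B b' ->
  S (a' + b') -> a' + b' <= a + b -> a <= a'].
have Tex s : S s -> exists a b, T a b /\ a + b <= s.
  move=> Ss; have [a0 [b0 [Aa0 Bb0 es]]] := SAB s Ss.
  have [a [[Aa [b [Bb Sab abs]]] mina]] :
      exists a, (A a /\ exists b, [/\ B b, S (a + b) & a + b <= s]) /\
        forall a', (A a' /\ exists b, [/\ B b, S (a' + b) & a' + b <= s]) ->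
        a <= a'.
    apply: wA => [i []//|]; exists a0; split=> //; exists b0.
    by rewrite -es; split.
  exists a, b; split=> //; split=> // a' b' Aa' Bb' Sab' le'.
  apply: mina; split=> //; exists b'; split=> //.
  exact: le_trans le' abs.
have [b [[a [Aa Bb Sab Tab]] minb]] : exists b, (exists a, T a b) /\
    forall b', (exists a, T a b') -> b <= b'.
  apply: wB => [b [a []]//|].
  by have [a [b [Tab _]]] := Tex _ Ss0; exists b, a.
exists (a + b); split=> // s Ss.
have [a' [b' [Tab' les]]] := Tex s Ss.
apply: le_trans les; case: (lerP (a + b) (a' + b')) => // lt'.
have aa' : a <= a' by case: Tab' => ? ? ? _; apply: (Tab a' b') => //; apply: ltW.
have bb' : b <= b' by apply: minb; exists a'.
lra.
Qed.

(** A set well-ordered in both directions is finite: a least element with infinite initial segment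
    would have a greatest predecessor, whose initial segment is already infinite. *)
Lemma wo_finite (P : rat -> Prop) : wo P ->
  (forall S : rat -> Prop, (forall i, S i -> P i) -> (exists i, S i) ->
    exists i, S i /\ forall j, S j -> j <= i) ->
  exists2 s : seq rat, uniq s & forall i, P i -> i \in s.
Proof.
move=> wP mP.
suff [s sP] : exists s : seq rat, forall i, P i -> i \in s.
  by exists (undup s); rewrite ?undup_uniq// => i /sP; rewrite mem_undup.
pose fin i := exists s : seq rat, forall j, P j -> j <= i -> j \in s.
have finP i : P i -> fin i.
  move=> Pi; apply: contrapT => nfi.
  have [m [[Pm nfm] minm]] : exists m, (P m /\ ~ fin m) /\
      forall j, (P j /\ ~ fin j) -> m <= j.
    by apply: wP => [j []//|]; exists i.
  apply: nfm.
  have [[j [Pj ltj]]|no] := pselect (exists j, P j /\ j < m); last first.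
    exists [:: m] => j Pj; rewrite le_eqVlt inE => /orP[//|ltj].
    by case: no; exists j.
  have [M [[PM ltM] maxM]] : exists j, (P j /\ j < m) /\
      forall k, (P k /\ k < m) -> k <= j.
    by apply: mP => [k []//|]; exists j.
  have [s sM] : fin M.
    by apply: contrapT => nfM; have := minm M (conj PM nfM); rewrite leNgt ltM.
  exists (m :: s) => k Pk; rewrite le_eqVlt inE => /orP[->//|ltk].
  by rewrite sM ?orbT//; apply: maxM.
have [[i Pi]|no] := pselect (exists i, P i); last first.
  by exists [::] => i Pi; case: no; exists i.
have [M [PM maxM]] := mP P (fun _ h => h) (ex_intro _ i Pi).
have [s sM] := finP M PM.
by exists s => k Pk; apply: sM => //; apply: maxM.
Qed.

(** Reflection at [k] reverses the order, so the well-ordering of [B] provides greatest elements and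
    [wo_finite] applies. *)
Lemma conv_finite (A B : rat -> Prop) (k : rat) : wo A -> wo B ->
  exists2 s : seq rat, uniq s & forall i, A i -> B (k - i) -> i \in s.
Proof.
move=> wA wB.
have [|S SP [i Si]|s us sP] := @wo_finite (fun i => A i /\ B (k - i)).
- by apply: wo_sub wA => i [].
- have [||m [Sm minm]] := wB (fun j => S (k - j)).
  + by move=> j /SP[_]; rewrite subKr.
  + by exists (k - i); rewrite subKr.
  exists (k - m); split=> // j Sj.
  have := minm (k - j); rewrite subKr => /(_ Sj); lra.
by exists s => // i Ai Bi; apply: sP.
Qed.

(** * Convolution of series with well-ordered support *)

Section Convolution.
Variable K : closedFieldType.
Implicit Types x y z : rat -> K.

(** Any duplicate-free list covering the contributing exponents will do, so several products can be
    expanded over one common list. *)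
Lemma hmul_seq x y k (s : seq rat) : uniq s ->
  (forall i, x i != 0 -> y (k - i) != 0 -> i \in s) ->
  hmul x y k = \sum_(i <- s) x i * y (k - i).
Proof.
move=> us sP; rewrite /hmul [RHS]fsbig_seq//.
apply/esym; apply: fsbig_widen => // i [_ /= /negP nis].
apply/eqP; apply: contraNT nis; rewrite mulf_eq0 negb_or => /andP[xi yi].
exact: sP.
Qed.

Lemma hmul_neq0 x y k : hmul x y k != 0 -> exists i, x i != 0 /\ y (k - i) != 0.
Proof.
apply: contra_neqP => no; rewrite /hmul fsbig1// => i _.
apply/eqP; rewrite mulf_eq0; apply/negPn/negP; rewrite negb_or => /andP[xi yi].
by apply: no; exists i.
Qed.

Lemma wo_hahn (P : rat -> Prop) x : wo P -> (forall i, x i != 0 -> P i) -> hahn x.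
Proof. by move=> wP xP; apply: (@wo_sub P). Qed.

Lemma hahn_zero : hahn (@hzero K).
Proof. by move=> S SP [i /SP]; rewrite eqxx. Qed.

Lemma wo1 (q : rat) : wo (eq q).
Proof. by move=> S SP [i Si]; exists i; split=> // j /SP <-; rewrite (SP i Si). Qed.

Lemma hahn_one : hahn (@hone K).
Proof.
apply: (wo_hahn (@wo1 0)) => i; rewrite /hone.
by case: (i =P 0) => [->|]; rewrite ?eqxx.
Qed.

Lemma hahn_add x y : hahn x -> hahn y -> hahn (hadd x y).
Proof.
move=> hx hy; apply: (wo_hahn (wo_union hx hy)) => i; rewrite /hadd.
by have [->|] := eqVneq (x i) 0; [rewrite add0r; right|left].
Qed.

Lemma hahn_opp x : hahn x -> hahn (fun i => - x i).
Proof. by move=> hx; apply: (wo_hahn hx) => i; rewrite oppr_eq0. Qed.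

Lemma hahn_mul x y : hahn x -> hahn y -> hahn (hmul x y).
Proof.
move=> hx hy; apply: (wo_hahn (wo_add hx hy)) => k /hmul_neq0 [i [xi yi]].
by exists i, (k - i); split=> //; ring.
Qed.

Lemma hmulC x y : hahn x -> hahn y -> hmul x y = hmul y x.
Proof.
move=> hx hy; apply: funext => k.
have [s us sP] := conv_finite k hx hy.
rewrite (hmul_seq us sP) (@hmul_seq y x k [seq k - i | i <- s]).
- rewrite big_map; apply: eq_bigr => i _.
  by rewrite subKr mulrC.
- by rewrite map_inj_uniq// => i j; lra.
move=> i yi xi; apply/mapP; exists (k - i); last by rewrite subKr.
by apply: sP => //; rewrite subKr.
Qed.

Lemma hmul1 x : hmul (@hone K) x = x.
Proof.
apply: funext => k; rewrite (@hmul_seq _ _ k [:: 0])//.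
  by rewrite big_seq1 /hone eqxx mul1r subr0.
by move=> i; rewrite /hone inE; case: (i == 0) => //=; rewrite eqxx.
Qed.

Lemma hmulDl x y z : hahn x -> hahn y -> hahn z ->
  hmul (hadd x y) z = hadd (hmul x z) (hmul y z).
Proof.
move=> hx hy hz; apply: funext => k.
have [s us sP] := conv_finite k hx hz.
have [t ut tP] := conv_finite k hy hz.
pose r := undup (s ++ t).
have ur : uniq r by apply: undup_uniq.
rewrite /hadd (@hmul_seq x z k r) ?(@hmul_seq y z k r) ?(@hmul_seq _ z k r)//.
- by rewrite -big_split; apply: eq_bigr => i _; rewrite mulrDl.
- move=> i xyi zi; rewrite mem_undup mem_cat.
  have [xi0|xi0] := eqVneq (x i) 0; last by rewrite sP.
  by rewrite tP ?orbT//; move: xyi; rewrite xi0 add0r.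
- by move=> i yi zi; rewrite mem_undup mem_cat tP ?orbT.
- by move=> i yi zi; rewrite mem_undup mem_cat sP.
Qed.

Lemma hmulA x y z : hahn x -> hahn y -> hahn z ->
  hmul x (hmul y z) = hmul (hmul x y) z.
Proof.
move=> hx hy hz; apply: funext => k.
(* [I] covers the exponents contributed jointly by [x] and [y], [J] those contributed by [x] alone;
   both sides become the same double sum over [I] and [J]. *)
have [I uI IP] := conv_finite k (wo_add hx hy) hz.
have [J uJ JP] := conv_finite k hx (wo_add hy hz).
rewrite (@hmul_seq x _ k J)//; last first.
  move=> i xi /hmul_neq0 [j [yj zj]]; apply: JP => //.
  by exists j, (k - i - j); split=> //; ring.
rewrite (@hmul_seq _ z k I)//; last first.
  move=> i /hmul_neq0 [j [xj yj]] zi; apply: IP => //.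
  by exists j, (i - j); split=> //; ring.
have E i : hmul x y i * z (k - i) = \sum_(j <- J) x j * y (i - j) * z (k - i).
  have [->|zi] := eqVneq (z (k - i)) 0.
    by rewrite mulr0 big1// => j _; rewrite mulr0.
  rewrite (hmul_seq uJ) ?mulr_suml// => j xj yj.
  by apply: JP => //; exists (i - j), (k - i); split=> //; ring.
have F j : x j * hmul y z (k - j) = \sum_(i <- I) x j * y (i - j) * z (k - i).
  have [->|xj] := eqVneq (x j) 0.
    by rewrite mul0r big1// => i _; rewrite !mul0r.
  rewrite (@hmul_seq _ _ _ [seq i - j | i <- I]).
  - rewrite big_map mulr_sumr; apply: eq_bigr => i _.
    by rewrite mulrA; congr (_ * z _); ring.
  - by rewrite map_inj_uniq// => ? ?; apply: addIr.
  move=> l yl zl; apply/mapP; exists (l + j); last by rewrite addrK.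
  apply: IP; first by exists j, l; split=> //; ring.
  by have -> : k - (l + j) = k - j - l by ring.
rewrite (eq_bigr _ (fun j _ => F j)) (eq_bigr _ (fun i _ => E i)).
exact: exchange_big.
Qed.
End Convolution.

(** * The integral domain of Hahn series *)

Section HahnRing.
Variable K : closedFieldType.

Record hser := Hser { hco :> rat -> K; hcoP : hahn hco }.
Arguments hcoP : clear implicits.

HB.instance Definition _ := gen_eqMixin hser.
HB.instance Definition _ := gen_choiceMixin hser.

Lemma hserP (x y : hser) : (forall i, x i = y i) -> x = y.
Proof.
case: x y => [x hx] [y hy] /= /funext xy; move: hx hy; rewrite xy => hx hy.
by rewrite (Prop_irrelevance hx hy).
Qed.

Definition hser0 := Hser (@hahn_zero K).
Definition hser1 := Hser (@hahn_one K).
Definition hserD (x y : hser) := Hser (hahn_add (hcoP x) (hcoP y)).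
Definition hserN (x : hser) := Hser (hahn_opp (hcoP x)).
Definition hserM (x y : hser) := Hser (hahn_mul (hcoP x) (hcoP y)).

Fact hserDA : associative hserD.
Proof. by move=> x y z; apply: hserP => i; rewrite /= /hadd /= /hadd addrA. Qed.
Fact hserDC : commutative hserD.
Proof. by move=> x y; apply: hserP => i; rewrite /= /hadd addrC. Qed.
Fact hser0D : left_id hser0 hserD.
Proof. by move=> x; apply: hserP => i; rewrite /= /hadd add0r. Qed.
Fact hserND : left_inverse hser0 hserN hserD.
Proof. by move=> x; apply: hserP => i; rewrite /= /hadd addNr. Qed.
HB.instance Definition _ := GRing.isZmodule.Build hser hserDA hserDC hser0D hserND.

Fact hserMA : associative hserM.
Proof.
by move=> x y z; apply: hserP => i; rewrite /= hmulA//; apply: hcoP.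
Qed.
Fact hserMC : commutative hserM.
Proof. by move=> x y; apply: hserP => i; rewrite /= hmulC//; apply: hcoP. Qed.
Fact hser1M : left_id hser1 hserM.
Proof. by move=> x; apply: hserP => i; rewrite /= hmul1. Qed.
Fact hserMDl : left_distributive hserM hserD.
Proof.
by move=> x y z; apply: hserP => i; rewrite /= hmulDl//; apply: hcoP.
Qed.
Fact hser1_neq0 : hser1 != 0.
Proof.
apply/eqP => /(congr1 (fun x => hco x 0)) /eqP.
by rewrite /= /hone eqxx oner_eq0.
Qed.
HB.instance Definition _ := GRing.Zmodule_isComNzRing.Build hser
  hserMA hserMC hser1M hserMDl hser1_neq0.

Lemma hco0 i : (0 : hser) i = 0. Proof. by []. Qed.
Lemma hcoD (x y : hser) i : (x + y) i = x i + y i. Proof. by []. Qed.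
Lemma hcoN (x : hser) i : (- x) i = - x i. Proof. by []. Qed.
Lemma hcoB (x y : hser) i : (x - y) i = x i - y i. Proof. by []. Qed.
Lemma hcoM (x y : hser) : x * y = hmul x y :> (rat -> K). Proof. by []. Qed.

Lemma hco_sum I (r : seq I) P (F : I -> hser) i :
  (\sum_(j <- r | P j) F j) i = \sum_(j <- r | P j) F j i.
Proof. by elim/big_rec2: _ => // j a b _ <-. Qed.

Lemma hcoX (x : hser) n : x ^+ n = hexp x n :> (rat -> K).
Proof. by elim: n => [//|n IH]; rewrite exprS hcoM IH. Qed.

Definition lowest (x : hser) m := x m != 0 /\ forall i, x i != 0 -> m <= i.

Lemma lowestP (x : hser) : x != 0 -> exists m, lowest x m.
Proof.
move=> x0; suff [i xi] : exists i, x i != 0.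
  by apply: (hcoP x); [move=> j; apply | exists i].
apply: contrapT => no; move/eqP: x0; apply; apply: hserP => i.
by apply/eqP/negPn/negP => xi; apply: no; exists i.
Qed.

Lemma lowest_lt (x : hser) m i : lowest x m -> i < m -> x i = 0.
Proof.
by move=> [_ mx] im; apply/eqP/negPn/negP => /mx; rewrite leNgt im.
Qed.

Lemma lowestM (x y : hser) m n : lowest x m -> lowest y n ->
  (x * y) (m + n) = x m * y n.
Proof.
move=> lx ly; rewrite hcoM (@hmul_seq _ _ _ _ [:: m])//.
  by rewrite big_seq1 addrAC subrr add0r.
move=> i xi yi; rewrite inE; have := lx.2 i xi; have := ly.2 _ yi.
by move=> ? ?; apply/eqP; lra.
Qed.

(** Integral domains carry a unit structure, so an inverse is chosen classically where one exists;
    for nonzero Puiseux series [puiseux_inv] constructs one. *)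
Definition hserV (x : hser) : hser :=
  if pselect (exists y, y * x = 1) is left e then projT1 (cid e) else x.
Definition hser_unit : {pred hser} := fun x => `[< exists y, y * x = 1 >].

Fact hserVM : {in hser_unit, left_inverse 1 hserV *%R}.
Proof.
move=> x /asboolP xu; rewrite /hserV; case: pselect => // e.
exact: projT2 (cid e).
Qed.
Fact hser_unitP x y : y * x = 1 -> hser_unit x.
Proof. by move=> xy; apply/asboolP; exists y. Qed.
Fact hserV_out : {in [predC hser_unit], hserV =1 id}.
Proof. by move=> x /asboolPn nx; rewrite /hserV; case: pselect. Qed.
HB.instance Definition _ := GRing.ComNzRing_hasMulInverse.Build hser
  hserVM hser_unitP hserV_out.

Fact hser_domain (x y : hser) : x * y = 0 -> (x == 0) || (y == 0).
Proof.
move=> xy0; rewrite -implyNb; apply/implyP => /lowestP [m lx].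
apply/negPn/negP => /lowestP [n ly]; have /eqP := lowestM lx ly.
rewrite xy0 hco0 eq_sym mulf_eq0 => /orP[] E; [move: lx.1|move: ly.1]; by rewrite E.
Qed.
HB.instance Definition _ := GRing.ComUnitRing_isIntegral.Build hser hser_domain.

End HahnRing.

Arguments hcoP {K} h : rename.

(** * Puiseux series *)

Section CharP.
Variables (R : comNzRingType) (p : nat).
Hypothesis charR : p \in [pchar R].

Lemma pchar_expD (x y : R) j : (x + y) ^+ (p ^ j) = x ^+ (p ^ j) + y ^+ (p ^ j).
Proof.
apply: exprDn_pchar; rewrite pnatX pnatE ?charR//.
exact: (pcharf_prime charR).
Qed.

Lemma pchar_exp_sum I (r : seq I) P (F : I -> R) j :
  (\sum_(i <- r | P i) F i) ^+ (p ^ j) = \sum_(i <- r | P i) F i ^+ (p ^ j).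
Proof.
have p0 := prime_gt0 (pcharf_prime charR).
apply: (big_morph (fun x => x ^+ (p ^ j))) => [x y|]; first exact: pchar_expD.
by rewrite expr0n -leqn0 leqNgt expn_gt0 p0.
Qed.
End CharP.

Section Monomials.
Variable K : closedFieldType.
Implicit Types x y z : hser K.

Lemma hahn_mono (c : K) (q : rat) : hahn (fun i => if i == q then c else 0).
Proof.
apply: (wo_hahn (@wo1 q)) => i; case: (i =P q) => [->//|_].
by rewrite eqxx.
Qed.
Definition mono (c : K) (q : rat) : hser K := Hser (@hahn_mono c q).

Lemma monoE c q i : mono c q i = if i == q then c else 0. Proof. by []. Qed.

Lemma mono_mulE c q x i : (mono c q * x) i = c * x (i - q).
Proof.
rewrite hcoM (@hmul_seq _ _ _ _ [:: q])//.
  by rewrite big_seq1 monoE eqxx.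
by move=> j; rewrite monoE inE; case: (j == q) => //=; rewrite eqxx.
Qed.

Lemma mono1 : mono 1 0 = 1.
Proof. exact: hserP. Qed.

Lemma monoM c d q r : mono c q * mono d r = mono (c * d) (q + r).
Proof.
apply: hserP => i; rewrite mono_mulE !monoE subr_eq (addrC r).
by case: eqP; rewrite ?mulr0.
Qed.

Lemma monoX c q n : mono c q ^+ n = mono (c ^+ n) (q *+ n).
Proof.
elim: n => [|n IH]; first by rewrite !expr0 mulr0n -mono1.
by rewrite exprS IH monoM -exprS mulrS.
Qed.

Lemma mono_eq0 c q : (mono c q == 0) = (c == 0).
Proof.
apply/eqP/eqP => [/(congr1 (fun x => hco x q))|->].
  by rewrite monoE eqxx hco0.
by apply: hserP => i; rewrite monoE; case: eqP.
Qed.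

(** Source of causality, with [s = 0]: if [x] has positive order and [y] is the difference of two
    series that agree below [t], the product vanishes up to and including [t]. *)
Lemma hser_mul_eq0 x y s t k : (forall i, x i != 0 -> s < i) ->
  (forall i, y i != 0 -> t <= i) -> k <= s + t -> (x * y) k = 0.
Proof.
move=> xs yt kst; apply: contrapT => /eqP; rewrite hcoM => /hmul_neq0 [i [xi yi]].
by have := xs _ xi; have := yt _ yi; lra.
Qed.

Lemma hahn_restr (C : rat -> bool) x : hahn (fun i => if C i then x i else 0).
Proof.
apply: (wo_hahn (hcoP x)) => i; by case: (C i) => //; rewrite eqxx.
Qed.
Definition hrestr C x : hser K := Hser (@hahn_restr C x).
Lemma hrestrE C x i : hrestr C x i = if C i then x i else 0. Proof. by []. Qed.

Lemma hser_exp_supp (P : nat -> rat -> Prop) x n :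
  (forall i, x i != 0 -> P 1%N i) ->
  (forall m i j, P 1%N i -> P m.+1 j -> P m.+2 (i + j)) ->
  forall i, (x ^+ n.+1) i != 0 -> P n.+1 i.
Proof.
move=> xP PD; elim: n => [|n IH] i; first by rewrite expr1; apply: xP.
rewrite exprS hcoM => /hmul_neq0 [j [xj xij]].
have -> : i = j + (i - j) by ring.
by apply: PD; [apply: xP|apply: IH].
Qed.

Variable p : nat.
Hypothesis charK : p \in [pchar K].
Let p_pr := pcharf_prime charK.
Let p_gt0 := prime_gt0 p_pr.

Lemma hser_pchar : p \in [pchar hser K].
Proof.
rewrite inE p_pr /=; apply/eqP; apply: hserP => i.
have E n : (n%:R : hser K) i = (1 : hser K) i *+ n.
  by elim: n => [//|n IH]; rewrite mulrS hcoD IH mulrS.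
by rewrite E -mulr_natr (pcharf0 charK) mulr0.
Qed.

(* Split x at i/p: the p-th powers of the two outer parts do not reach i. *)
Lemma hser_frobE x i : (x ^+ p) i = x (i / p%:R) ^+ p.
Proof.
have p0 : 0 < (p%:R : rat) by rewrite ltr0n.
set s := i / p%:R; have es : i = s * p%:R by rewrite mulfVK// gt_eqF.
have xE : x = mono (x s) s + (hrestr (fun j => j < s) x + hrestr (fun j => s < j) x).
  apply: hserP => j; rewrite !hcoD monoE !hrestrE.
  by case: ltgtP => [||->]; rewrite ?addr0 ?add0r.
have pE := prednK p_gt0.
rewrite {1}xE -[p in LHS]expn1 !(pchar_expD hser_pchar) expn1 !hcoD monoX monoE.
rewrite -mulr_natr -es eqxx.
have -> : (hrestr (fun j => j < s) x ^+ p) i = 0.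
  apply: contrapT => /eqP; rewrite -pE => h.
  have := @hser_exp_supp (fun n j => j < s * n%:R) _ _ _ _ _ h.
  rewrite pE -es ltxx => H; suff: false by [].
  apply: H => [j|m j k]; last by rewrite !mulrSr; lra.
  by rewrite hrestrE; case: ifP; rewrite ?eqxx ?mulr1.
have -> : (hrestr (fun j => s < j) x ^+ p) i = 0.
  apply: contrapT => /eqP; rewrite -pE => h.
  have := @hser_exp_supp (fun n j => s * n%:R < j) _ _ _ _ _ h.
  rewrite pE -es ltxx => H; suff: false by [].
  apply: H => [j|m j k]; last by rewrite !mulrSr; lra.
  by rewrite hrestrE; case: ifP; rewrite ?eqxx ?mulr1.
by rewrite !addr0.
Qed.

Lemma hser_frobXE x j i : (x ^+ (p ^ j)) i = x (i / (p ^ j)%:R) ^+ (p ^ j).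
Proof.
elim: j i => [|j IH] i; first by rewrite expn0 !expr1 divr1.
rewrite expnSr !exprM hser_frobE IH natrM invfM mulrA.
by rewrite [i / _ / _]mulrAC.
Qed.

End Monomials.

Lemma absz_numq_nat (n : nat) : `|numq n%:R|%N = n.
Proof. by rewrite pmulrn numq_int. Qed.

Section Puiseux.
Variable K : closedFieldType.
Implicit Types x y z : hser K.

Definition ramified (a : nat) x := forall i, x i != 0 -> a%:R * i \is a Num.int.
Definition puiseux x := exists2 a, (0 < a)%N & ramified a x.

Lemma ramified_mulr a b x : ramified a x -> ramified (a * b) x.
Proof.
by move=> xa i /xa h; rewrite natrM mulrAC rpredM// rpred_nat.
Qed.

Lemma ramified_mull a b x : ramified a x -> ramified (b * a) x.
Proof. by rewrite mulnC; apply: ramified_mulr. Qed.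

Lemma ramifiedD a x y : ramified a x -> ramified a y -> ramified a (x + y).
Proof.
move=> xa ya i; rewrite hcoD; have [->|/xa//] := eqVneq (x i) 0.
by rewrite add0r; apply: ya.
Qed.

Lemma ramifiedM a x y : ramified a x -> ramified a y -> ramified a (x * y).
Proof.
move=> xa ya i; rewrite hcoM => /hmul_neq0 [j [/xa xj /ya yj]].
have -> : a%:R * i = a%:R * j + a%:R * (i - j) by ring.
exact: rpredD.
Qed.

Lemma ramifiedN a x : ramified a x -> ramified a (- x).
Proof. by move=> xa i; rewrite hcoN oppr_eq0; apply: xa. Qed.

Lemma puiseux_pair x y : puiseux x -> puiseux y ->
  exists2 a, (0 < a)%N & ramified a x /\ ramified a y.
Proof.
move=> [a a0 xa] [b b0 yb]; exists (a * b)%N; first by rewrite muln_gt0 a0.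
by split; [apply: ramified_mulr | apply: ramified_mull].
Qed.

Lemma puiseuxD x y : puiseux x -> puiseux y -> puiseux (x + y).
Proof. by move=> px /(puiseux_pair px)[a a0 [? ?]]; exists a => //; apply: ramifiedD. Qed.
Lemma puiseuxM x y : puiseux x -> puiseux y -> puiseux (x * y).
Proof. by move=> px /(puiseux_pair px)[a a0 [? ?]]; exists a => //; apply: ramifiedM. Qed.
Lemma puiseuxN x : puiseux x -> puiseux (- x).
Proof. by move=> [a a0 ?]; exists a => //; apply: ramifiedN. Qed.

Lemma puiseux_mono c q : puiseux (mono c q).
Proof.
exists `|denq q|%N; first by rewrite absz_gt0 denq_neq0.
move=> i; rewrite monoE; case: (i =P q) => [->|]; last by rewrite eqxx.
by move=> _; rewrite natr_absz ger0_norm ?denq_ge0// mulrC -numqE rpred_int.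
Qed.

Lemma puiseux0 : puiseux 0.
Proof. by exists 1%N => // i; rewrite hco0 eqxx. Qed.
Lemma puiseux1 : puiseux 1.
Proof. by rewrite -mono1; apply: puiseux_mono. Qed.

Lemma puiseuxX x n : puiseux x -> puiseux (x ^+ n).
Proof.
by move=> px; elim: n => [|n IH]; [apply: puiseux1|rewrite exprS; apply: puiseuxM].
Qed.

Lemma puiseux_sum I (r : seq I) (P : pred I) (F : I -> hser K) :
  (forall i, P i -> puiseux (F i)) -> puiseux (\sum_(i <- r | P i) F i).
Proof. by move=> PF; elim/big_ind: _ => //; [apply: puiseux0|apply: puiseuxD]. Qed.

Lemma puiseux_common n (F : nat -> hser K) :
  (forall j, (j < n)%N -> puiseux (F j)) ->
  exists2 a, (0 < a)%N & forall j, (j < n)%N -> ramified a (F j).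
Proof.
elim: n => [|n IH] PF; first by exists 1%N.
have [j jn|a a0 aF] := IH; first by apply: PF; rewrite ltnW.
have [b b0 bF] := PF n (ltnSn n).
exists (a * b)%N; first by rewrite muln_gt0 a0.
move=> j; rewrite ltnS leq_eqVlt => /orP[/eqP->|jn]; first exact: ramified_mull.
by apply: ramified_mulr; apply: aF.
Qed.

(* Power series in t^(1/a). *)
Definition holomorphic (a : nat) x := forall i, x i != 0 -> 0 <=
    i /\ a%:R * i \is a Num.int.

Lemma wo_nat_above (a : nat) (lo : rat) : (0 < a)%N ->
  wo (fun i => lo <= i /\ a%:R * i \is a Num.int).
Proof.
move=> a0 S SP [i0 Si0].
have a0R : 0 < (a%:R : rat) by rewrite ltr0n.
pose M := Num.bound `|a%:R * lo|.
have MP i : S i -> exists n : nat, a%:R * i + M%:R = n%:R.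
  move=> /SP[loi ai]; apply/natrP; rewrite natrEint rpredD ?rpred_nat//=.
  have := archi_boundP (normr_ge0 (a%:R * lo)); rewrite -/M => hM.
  have : - (a%:R * lo) <= `|a%:R * lo| by rewrite -normrN ler_norm.
  have : a%:R * lo <= a%:R * i by rewrite ler_pM2l.
  lra.
have ex : exists n : nat, `[< exists i, S i /\ a%:R * i + M%:R = n%:R >].
  by have [n en] := MP i0 Si0; exists n; apply/asboolP; exists i0.
case: (ex_minnP ex) => n /asboolP[i [Si ein]] nmin.
exists i; split=> // j Sj; have [m em] := MP j Sj.
have /nmin : `[< exists i, S i /\ a%:R * i + M%:R = m%:R >].
  by apply/asboolP; exists j.
by rewrite -(ler_nat rat) -em -ein lerD2r ler_pM2l.
Qed.

Definition series_of (a : nat) (f : nat -> K) : rat -> K :=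
  fun i => if (0 <= i) && (a%:R * i \is a Num.int) then f `|numq (a%:R * i)|%N else 0.

Lemma hahn_series_of a f : (0 < a)%N -> hahn (series_of a f).
Proof.
move=> a0; apply: (wo_hahn (@wo_nat_above a 0 a0)) => i; rewrite /series_of.
by case: andP => // _; rewrite eqxx.
Qed.

(** Iterating from 0, the coefficient of index n is settled after n+1 steps, so the diagonal of the
    iterates is a fixed point. *)
Lemma causal_fixpoint (Phi : (nat -> K) -> nat -> K) :
  (forall f g n, (forall m, (m < n)%N -> f m = g m) -> Phi f n = Phi g n) ->
  exists f, forall n, Phi f n = f n.
Proof.
move=> causal; pose F k := iter k Phi (fun=> 0).
have stab n k : (n < k)%N -> F k n = F n.+1 n.
  elim/ltn_ind: n k => n IH [//|k] nk; rewrite /F !iterS; apply: causal => m mn.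
  by rewrite -!/(F _) IH ?(leq_trans mn)// [RHS]IH.
exists (fun n => F n.+1 n) => n; rewrite {2}/F iterS -/(F n).
by apply: causal => m mn; rewrite stab.
Qed.

(** On the grid (1/a)N, dependence on the exponents strictly below [s] is dependence on finitely
    many earlier coefficients, so [causal_fixpoint] applies. *)
Lemma series_fixpoint a (Psi : hser K -> hser K) : (0 < a)%N ->
  (forall y, holomorphic a y -> holomorphic a (Psi y)) ->
  (forall y z s, holomorphic a y -> holomorphic a z ->
     (forall i, i < s -> y i = z i) -> forall i, i <= s -> Psi y i = Psi z i) ->
  exists2 y, holomorphic a y & Psi y = y.
Proof.
move=> a0 Psih causal.
have a0R : 0 < (a%:R : rat) by rewrite ltr0n.
pose emb f : hser K := Hser (@hahn_series_of a f a0).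
have embh f : holomorphic a (emb f).
  by move=> i; rewrite /= /series_of; case: andP => //; rewrite eqxx.
have intE (i : rat) : 0 <= i -> a%:R * i \is a Num.int -> exists n : nat, a%:R * i = n%:R.
  by move=> i0 ai; apply/natrP; rewrite natrEint ai mulr_ge0// ltW.
have [f g n fg|f ff] := @causal_fixpoint (fun f n => Psi (emb f) (n%:R / a%:R)).
  apply: (causal _ _ (n%:R / a%:R)) => // i.
  rewrite ltr_pdivlMr// mulrC /= /series_of => ltin.
  case: andP => // -[i0 ai]; apply: fg.
  have [m em] := intE _ i0 ai.
  by rewrite em absz_numq_nat -(ltr_nat rat) -em.
exists (emb f); first exact: embh.
apply: hserP => i; rewrite [RHS]/= /series_of; case: ifPn => [/andP[i0 ai]|].
  have [m em] := intE _ i0 ai.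
  by rewrite em absz_numq_nat -ff -em mulrC mulKf// gt_eqF.
move=> no; apply/eqP/negPn/negP => /(Psih _ (embh f))[i0 ai].
by move/negP: no; apply; rewrite i0 ai.
Qed.

Lemma holomorphicD a x y : holomorphic a x -> holomorphic a y -> holomorphic a (x + y).
Proof.
move=> xa ya i; rewrite hcoD; have [->|/xa//] := eqVneq (x i) 0.
by rewrite add0r; apply: ya.
Qed.

Lemma holomorphicM a x y : holomorphic a x -> holomorphic a y -> holomorphic a (x * y).
Proof.
move=> xa ya i; rewrite hcoM => /hmul_neq0 [j [/xa[j0 xj] /ya[ij0 yj]]].
split; first lra.
have -> : a%:R * i = a%:R * j + a%:R * (i - j) by ring.
exact: rpredD.
Qed.

Lemma holomorphicN a x : holomorphic a x -> holomorphic a (- x).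
Proof. by move=> xa i; rewrite hcoN oppr_eq0; apply: xa. Qed.

Lemma holomorphic_const a c : holomorphic a (mono c 0).
Proof.
move=> i; rewrite monoE; case: (i =P 0) => [->|]; last by rewrite eqxx.
by rewrite mulr0 rpred0.
Qed.

Lemma holomorphicX a x n : holomorphic a x -> holomorphic a (x ^+ n).
Proof.
move=> xa; elim: n => [|n IH]; last by rewrite exprS; apply: holomorphicM.
by rewrite expr0 -mono1; apply: holomorphic_const.
Qed.

Lemma holomorphic_sum a I (r : seq I) (P : pred I) (F : I -> hser K) :
  (forall i, P i -> holomorphic a (F i)) -> holomorphic a (\sum_(i <- r | P i) F i).
Proof.
move=> PF; elim/big_ind: _ => //; last by move=> ? ?; apply: holomorphicD.
by move=> i; rewrite hco0 eqxx.
Qed.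

Lemma holomorphic_restr a C x : holomorphic a x -> holomorphic a (hrestr C x).
Proof.
by move=> xa i; rewrite hrestrE; case: (C i); [apply: xa|rewrite eqxx].
Qed.

Lemma holomorphicM0 a x y : holomorphic a x -> holomorphic a y ->
  (x * y) 0 = x 0 * y 0.
Proof.
move=> xa ya; rewrite hcoM (@hmul_seq _ _ _ _ [:: 0])//.
  by rewrite big_seq1 subr0.
move=> i /xa[i0 _] /ya[]; rewrite sub0r oppr_ge0 inE => i0' _.
by apply/eqP/le_anti/andP.
Qed.

Lemma holomorphic_pos a x i : holomorphic a x -> x 0 = 0 -> x i != 0 -> 0 < i.
Proof.
move=> xa x0 xi; have [i0 _] := xa _ xi; rewrite lt_neqAle i0 andbT.
by apply: contraNneq xi => <-; rewrite x0.
Qed.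

(** Write x = c + e with c the constant term. The inverse is the fixed point of y -> c^-1 (1 - e y),
    a causal map because e has positive order. *)
Lemma holomorphic_inv a x : (0 < a)%N -> holomorphic a x -> x 0 != 0 ->
  exists2 y, holomorphic a y & x * y = 1.
Proof.
move=> a0 xa x0; set c := x 0.
pose e := x - mono c 0.
have eh : holomorphic a e.
  by apply: holomorphicD => //; apply/holomorphicN/holomorphic_const.
have e0 : e 0 = 0 by rewrite hcoB monoE eqxx subrr.
pose Psi y := mono c^-1 0 * (1 - e * y).
have [y yh|y z s yh zh yz i lis|y yh yE] := series_fixpoint (Psi := Psi) a0.
- apply: holomorphicM; first exact: holomorphic_const.
  apply: holomorphicD; first by rewrite -mono1; apply: holomorphic_const.
  exact/holomorphicN/holomorphicM.
- rewrite /Psi !mono_mulE subr0 !hcoB; congr (_ * (_ - _)).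
  apply/eqP; rewrite -subr_eq0 -hcoB -mulrBr; apply/eqP.
  apply: (@hser_mul_eq0 _ _ _ 0 s); last by rewrite add0r.
    by move=> j; apply: (holomorphic_pos eh e0).
  move=> j; apply: contraNT; rewrite -ltNge => /yz js.
  by rewrite hcoB js subrr.
exists y => //.
have -> : x = mono c 0 + e by rewrite /e addrC subrK.
rewrite mulrDl -{1}yE /Psi mulrA monoM mulfV// addr0 mono1 mul1r.
by rewrite subrK.
Qed.

Lemma puiseux_inv x : puiseux x -> x != 0 -> exists2 y, puiseux y & x * y = 1.
Proof.
move=> [a a0 xa] /lowestP [m lm].
pose x' := mono 1 (- m) * x.
have xE i : x' i = x (i + m) by rewrite mono_mulE mul1r opprK.
have [|||y yh xy] := @holomorphic_inv a x' => //.
- move=> i; rewrite xE => xi; have := lm.2 _ xi => le; split; first lra.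
  have -> : a%:R * i = a%:R * (i + m) - a%:R * m by ring.
  by rewrite rpredB// xa//; case: lm.
- by rewrite xE add0r; case: lm.
exists (mono 1 (- m) * y); last by rewrite mulrCA mulrA.
by apply: puiseuxM; [apply: puiseux_mono|exists a => // i /yh[]].
Qed.

(** * Hensel lifting for additive polynomials *)

Section Newton.
Variable p : nat.
Hypothesis charK : p \in [pchar K].
Let p_pr := pcharf_prime charK.
Let p_gt0 := prime_gt0 p_pr.
Let p_gt1 := prime_gt1 p_pr.

(** Divide the additive polynomial by its variable: the quotient [g] is not constant since [delta k]
    is nonzero, and 0 is not a root of it since [delta 0] is nonzero. *)
Lemma residual_root n (delta : nat -> K) k : delta 0 != 0 -> (0 < k <= n)%N ->
  delta k != 0 ->
  exists2 c, c != 0 & \sum_(j < n.+1) delta j * c ^+ (p ^ j) = 0.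
Proof.
move=> d0 /andP[k0 kn] dk.
pose g : {poly K} := \sum_(j < n.+1) delta j *: 'X^((p ^ j).-1).
have predpj j l : ((p ^ j).-1 == (p ^ l).-1) = (j == l).
  rewrite -(inj_eq succn_inj) !prednK ?expn_gt0 ?p_gt0//.
  by rewrite eqn_exp2l.
have gE l : (l <= n)%N -> g`_((p ^ l).-1) = delta l.
  move=> ln; rewrite coef_sum (bigD1 (Ordinal (ln : l < n.+1)%N))//= coefZ coefXn.
  rewrite eqxx mulr1 big1 ?addr0// => j jl; rewrite coefZ coefXn predpj.
  by move: jl; rewrite -val_eqE /= eq_sym => /negPf ->; rewrite mulr0.
have [|c rc] := @closed_rootP K g _.
  apply/negP => /size_poly1P [c _ gc].
  have := gE k kn; rewrite gc coefC => /eqP.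
  have -> : ((p ^ k).-1 == 0)%N = false by rewrite (predpj k 0) gtn_eqF.
  by rewrite eq_sym (negPf dk).
have c0 : c != 0.
  apply: contraNneq d0 => c0; move: rc; rewrite c0 /root horner_coef0.
  by have := gE 0%N (leq0n n); rewrite expn0 /= => ->.
exists c => //; move/rootP: rc; rewrite horner_sum => gc.
have -> : \sum_(j < n.+1) delta j * c ^+ (p ^ j) = c * \sum_(j < n.+1) (delta j *:
    'X^((p ^ j).-1)).[c].
  rewrite mulr_sumr; apply: eq_bigr => j _; rewrite hornerZ hornerXn mulrCA -exprS.
  by rewrite prednK// expn_gt0 p_gt0.
by rewrite gc mulr0.
Qed.

(** The derivative of an additive polynomial is its linear coefficient, here a unit. A residual root
    [c] is therefore corrected by solving for the linear term: the powers y^(p^j) with j > 0 involve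
    at exponent i only the coefficient of y at i/p^j, which is strictly smaller when i > 0. *)
Lemma hensel_root a n (d : nat -> hser K) k : (0 < a)%N ->
  (forall j, (j <= n)%N -> holomorphic a (d j)) ->
  d 0%N 0 != 0 -> (0 < k <= n)%N -> d k 0 != 0 ->
  exists y, [/\ holomorphic a y, y != 0 & \sum_(j < n.+1) d j * y ^+ (p ^ j) = 0].
Proof.
move=> a0 dh d00 kn dk0.
have [c c0 cE] := residual_root (delta := fun j => d j 0) d00 kn dk0.
set delta := d 0%N 0 in d00 *.
pose e := d 0%N - mono delta 0.
have eh : holomorphic a e.
  by apply: holomorphicD; [apply: dh|apply/holomorphicN/holomorphic_const].
have e0 : e 0 = 0 by rewrite hcoB monoE eqxx subrr.
pose B := \sum_(j < n.+1) d j * mono c 0 ^+ (p ^ j).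
pose E y := e * y + \sum_(j < n) d j.+1 * y ^+ (p ^ j.+1) + B.
have Bh : holomorphic a B.
  apply: holomorphic_sum => j _; apply: holomorphicM; first by apply: dh; rewrite -ltnS.
  exact/holomorphicX/holomorphic_const.
have Eh y : holomorphic a y -> holomorphic a (E y).
  move=> yh; apply: holomorphicD => //; apply: holomorphicD; first exact: holomorphicM.
  by apply: holomorphic_sum => j _; apply: holomorphicM; [apply: dh|apply: holomorphicX].
(* Without the cut to positive exponents, the coefficient at 0 of y^(p^j) would depend on [y 0] and
   the map would not be causal. The cut is harmless: [EY0] shows that [E y] has no constant term, by
   the choice of [c]. *)
pose Psi y := hrestr (fun i => 0 < i) (mono (- delta^-1) 0 * E y).
have yX0 y j : y 0 = 0 -> (y ^+ (p ^ j)) 0 = 0.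
  by move=> y0; rewrite (hser_frobXE charK) mul0r y0 expr0n gtn_eqF// expn_gt0 p_gt0.
have [y yh|y z s yh zh yz i lis|y yh yE] := series_fixpoint (Psi := Psi) a0.
- apply: holomorphic_restr; apply: holomorphicM; first exact: holomorphic_const.
  exact: Eh.
- rewrite /Psi !hrestrE; case: ifP => // i0; rewrite !mono_mulE subr0; congr (_ * _).
  rewrite !hcoD; congr (_ + _ + _).
    apply/eqP; rewrite -subr_eq0 -hcoB -mulrBr; apply/eqP.
    apply: (@hser_mul_eq0 _ _ _ 0 s); last by rewrite add0r.
      by move=> j; apply: (holomorphic_pos eh e0).
    move=> j; apply: contraNT; rewrite -ltNge => /yz js.
    by rewrite hcoB js subrr.
  rewrite !hco_sum; apply: eq_bigr => j _.
  apply/eqP; rewrite -subr_eq0 -hcoB -mulrBr; apply/eqP.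
  apply: contrapT => /eqP; rewrite hcoM => /hmul_neq0 [l [dl]].
  have [l0 _] := dh _ (ltn_ord j) _ dl.
  rewrite hcoB !(hser_frobXE charK); set q := (p ^ j.+1)%N.
  have q1 : 1 < (q%:R : rat) by rewrite ltr1n -{1}(expn0 p) ltn_exp2l.
  have q0 : 0 < (q%:R : rat) by lra.
  have [ilneg|ilpos] := ltP (i - l) 0.
    have neg w : holomorphic a w -> w ((i - l) / q%:R) = 0.
      move=> wh; apply/eqP/negPn/negP => /wh[].
      by rewrite pmulr_lge0 ?invr_gt0// leNgt ilneg.
    by rewrite !neg// subrr eqxx.
  rewrite yz ?subrr ?eqxx// ltr_pdivrMr//.
  have s0 : 0 < s by apply: lt_le_trans i0 lis.
  have : s < s * q%:R by rewrite ltr_pMr.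
  lra.
have y0 : y 0 = 0 by rewrite -yE /Psi hrestrE ltxx.
have EY0 : (E y) 0 = 0.
  rewrite /E !hcoD (holomorphicM0 eh yh) y0 mulr0 add0r.
  rewrite hco_sum big1 ?add0r => [|j _]; last first.
    by rewrite (@holomorphicM0 a) ?yX0 ?mulr0//; [apply: dh|apply: holomorphicX].
  rewrite /B hco_sum -[RHS]cE; apply: eq_bigr => j _.
  rewrite (@holomorphicM0 a); first by rewrite monoX mul0rn monoE eqxx.
    by apply: dh; rewrite -ltnS.
  exact/holomorphicX/holomorphic_const.
have yE' : y = mono (- delta^-1) 0 * E y.
  rewrite -{1}yE; apply: hserP => i; rewrite /Psi hrestrE.
  case: ifPn => //; rewrite -leNgt le_eqVlt => /orP[/eqP->|i0].
    by rewrite mono_mulE subrr EY0 mulr0.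
  apply/esym/eqP/negPn/negP.
  move=> /(holomorphicM (@holomorphic_const a _) (Eh _ yh)) [].
  by rewrite leNgt i0.
exists (mono c 0 + y); split.
- by apply: holomorphicD => //; apply: holomorphic_const.
- apply: contraNneq c0 => /(congr1 (fun x => hco x 0)).
  by rewrite hcoD y0 monoE eqxx addr0 hco0 => ->.
under eq_bigr => j _ do rewrite (pchar_expD (hser_pchar charK)) mulrDr.
rewrite big_split /= -/B (big_ord_recl n) /= expn0 expr1.
have -> : d 0%N = mono delta 0 + e by rewrite /e addrC subrK.
have yK : mono delta 0 * y = - E y.
  rewrite {1}yE' mulrA monoM mulrN mulfV// addr0 -[RHS]mulN1r; congr (_ * _).
  by apply: hserP => i; rewrite hcoN -mono1 !monoE; case: eqP => //; rewrite oppr0.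
by rewrite mulrDl yK /E /bump /=; ring.
Qed.

End Newton.
End Puiseux.

(** * Additive relations *)

(* Elimination without division, so that the coefficients stay in S. *)
Lemma elimination (R : idomainType) (S : R -> Prop) (T : finType) n
    (A : {set T}) (c : T -> nat -> R) :
  S 0 -> S 1 -> (forall x y, S x -> S y -> S (x - y)) ->
  (forall x y, S x -> S y -> S (x * y)) ->
  (n < #|A|)%N -> (forall t k, S (c t k)) ->
  exists u : T -> R, [/\ forall t, S (u t), forall t, t \notin A -> u t = 0,
    exists t, u t != 0 & forall k, (k < n)%N -> \sum_t u t * c t k = 0].
Proof.
move=> S0 S1 SB SM; elim: n A c => [|n IH] A c nA Sc.
  have [t0 t0A] := card_gt0P nA.
  exists (fun t => (t == t0)%:R); split=> //.
  - by move=> t; case: (t == t0).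
  - by move=> t tA; case: eqP tA => // ->; rewrite t0A.
  - by exists t0; rewrite eqxx oner_neq0.
have [/existsP [t0 /andP[t0A ct0]]|no] := boolP [exists t, (t \in A) && (c t n != 0)];
  last first.
  have [u [uS uA un0 uc]] := IH A c (ltnW nA) Sc.
  exists u; split=> // k; rewrite ltnS leq_eqVlt => /orP[/eqP->|]; last exact: uc.
  apply: big1 => t _; have [tA|tA] := boolP (t \in A); last by rewrite uA ?mul0r.
  have : ~~ ((t \in A) && (c t n != 0)) by apply: contra no => h; apply/existsP; exists t.
  by rewrite tA /= negbK => /eqP->; rewrite mulr0.
have SD x y : S x -> S y -> S (x + y).
  by move=> Sx Sy; rewrite -[y]opprK -[- y]sub0r; apply: (SB) => //; apply: SB.
(* Cross-multiplication with the pivot row [t0] clears column [n]; giving [t0] the coefficient [- w]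
   turns a combination of the [c'] back into one of the [c]. *)
pose c' t k := c t0 n * c t k - c t n * c t0 k.
have [||u [uS uA [t1 ut1] uc]] := IH (A :\ t0) c'.
- by move: nA; rewrite (cardsD1 t0) t0A.
- by move=> t k; apply: SB; apply: (SM).
have u0 : u t0 = 0 by apply: uA; rewrite !inE eqxx.
pose w := \sum_t u t * c t n.
have uE t : (if t == t0 then - w else c t0 n * u t) = c t0 n * u t - (t == t0)%:R * w.
  by case: eqP => [->|_]; rewrite ?u0 ?mulr0 ?mul1r ?sub0r// mul0r subr0.
exists (fun t => if t == t0 then - w else c t0 n * u t); split.
- move=> t; case: eqP => _; last exact: SM.
  rewrite -[- w]sub0r; apply: (SB) => //; rewrite /w.
  by elim/big_ind: _ => // i _; apply: SM.
- move=> t tA; case: eqP => [et|/eqP nt]; first by rewrite et t0A in tA.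
  by rewrite uA ?mulr0// !inE negb_and tA orbT.
- exists t1; case: (t1 =P t0) => [et|_]; last by rewrite mulf_neq0.
  by rewrite et u0 eqxx in ut1.
move=> k kn.
have -> : \sum_t (if t == t0 then - w else c t0 n * u t) * c t k = \sum_t u t * c' t k.
  under eq_bigr => t _ do rewrite uE mulrBl.
  rewrite sumrB (bigD1 t0 (P := xpredT) (F := fun i => (i == t0)%:R * w * c i k))//=.
  rewrite [X in _ - (_ + X)]big1 => [|t /negPf->]; last by rewrite !mul0r.
  rewrite eqxx mul1r addr0 /w mulr_suml -sumrB; apply: eq_bigr => t _.
  by rewrite /c'; ring.
move: kn; rewrite ltnS leq_eqVlt => /orP[/eqP->|]; last exact: uc.
by apply: big1 => t _; rewrite /c' mulrC [c t n * _]mulrC subrr mul0r.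
Qed.

Section Additive.
Variable K : closedFieldType.
Implicit Types x y z : hser K.

Lemma hco_sum_hadd I (r : seq I) (F : I -> hser K) :
  (\sum_(j <- r) F j : rat -> K) = \big[@hadd K/@hzero K]_(j <- r) F j.
Proof. exact: (big_morph (@hco K)). Qed.

Lemma hahn_polyH (f : {poly K}) : hahn (polyH f).
Proof.
apply: (wo_hahn (@wo_nat_above 1 0 isT)) => i; rewrite /polyH mul1r.
by case: andP => // _; rewrite eqxx.
Qed.
Definition polyser (f : {poly K}) : hser K := Hser (@hahn_polyH f).

Lemma polyser_nat f (m : nat) : polyser f m%:R = f`_m.
Proof. by rewrite /= /polyH ler0n rpred_nat absz_numq_nat. Qed.

Lemma polyserE (f : {poly K}) (n : nat) : (size f <= n)%N -> polyser f = \sum_(m < n)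
    mono f`_m m%:R.
Proof.
move=> fn; apply: hserP => i; rewrite hco_sum.
have [/andP[i0 ii]|no] := boolP ((0 <= i) && (i \is a Num.int)).
  have [m ->] : exists m : nat, i = m%:R by apply/natrP; rewrite natrEint ii.
  rewrite polyser_nat; have [mn|nm] := ltnP m n.
    rewrite (bigD1 (Ordinal mn))// big1 => [|j jm]; first by rewrite monoE eqxx /= addr0.
    by rewrite monoE eqr_nat; move: jm; rewrite -val_eqE /= eq_sym => /negPf ->.
  rewrite nth_default ?(leq_trans fn)// big1// => j _.
  by rewrite monoE eqr_nat gtn_eqF// (leq_trans (ltn_ord j)).
rewrite [LHS]/= /polyH (negPf no) big1// => j _; rewrite monoE.
by case: eqP no => // ->; rewrite ler0n rpred_nat.
Qed.

Lemma polyserD f g : polyser (f + g) = polyser f + polyser g.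
Proof.
apply: hserP => i; rewrite hcoD /= /polyH.
by case: ifP => _; rewrite ?coefD ?addr0.
Qed.

Lemma polyser0 : polyser 0 = 0.
Proof. by apply: hserP => i; rewrite /= /polyH coef0; case: ifP. Qed.

Lemma polyser_eq0 f : (polyser f == 0) = (f == 0).
Proof.
apply/eqP/eqP => [f0|->]; last exact: polyser0.
by apply/polyP => m; rewrite -polyser_nat f0 coef0.
Qed.

Lemma puiseux_polyser f : puiseux (polyser f).
Proof.
rewrite (@polyserE f (size f))//; apply: puiseux_sum => i _.
exact: puiseux_mono.
Qed.

(** Multiplication by a polynomial respects the classes of exponents modulo Z. The part [z] of [x]
    with non-integral exponents is thus killed by the denominator, and vanishes in a domain. *)
Lemma Kt_laurent x : Kt x -> Klaurent x.
Proof.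
case=> f [g [g0 xg]] i xi; apply: contrapT => /negP nint.
pose z := hrestr (fun j => j \isn't a Num.int) x.
have : z * polyser g = 0.
  apply: hserP => k; apply: contrapT => /eqP; rewrite hcoM.
  have [kint|knint] := boolP (k \is a Num.int).
    case/hmul_neq0 => j []; rewrite hrestrE; case: ifPn => [nj _|]; last by rewrite eqxx.
    rewrite /= /polyH; case: andP => [[_ kj]|]; last by rewrite eqxx.
    by move: nj; rewrite -(subKr k j) rpredB.
  rewrite hco0; have := congr1 (fun h => h k) xg.
  rewrite {2}/polyH (negPf knint) andbF => <-.
  have [s us sP] := conv_finite k (hcoP x) (hcoP (polyser g)).
  rewrite !(@hmul_seq _ _ _ _ s)//; last first.
    by move=> j; rewrite hrestrE; case: ifP => //; [move=> _; apply: sP|rewrite eqxx].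
  rewrite (eq_bigr (fun j => x j * polyser g (k - j))) ?eqxx// => j _.
  rewrite hrestrE; case: ifPn => //; rewrite negbK => jint.
  rewrite /= /polyH; case: andP => [[_ kj]|]; rewrite ?mulr0//.
  by move: knint; rewrite -(subrK j k) rpredD.
move/eqP; rewrite mulf_eq0 polyser_eq0 (negPf g0) orbF => /eqP z0.
have := congr1 (fun h => hco h i) z0; rewrite hrestrE nint hco0 => xi0.
by rewrite xi0 eqxx in xi.
Qed.

Variable p : nat.
Hypothesis charK : p \in [pchar K].
Let p_pr := pcharf_prime charK.
Let p_gt0 := prime_gt0 p_pr.
Let p_gt1 := prime_gt1 p_pr.

(** The order s of the root makes c_0 w and c_k w^(p^k) equal in valuation, so s = (v_0 - v_k)/(p^k
    - 1). Taking the index of largest such [slope] ensures that no other term has smaller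
    valuation. *)
Lemma additive_root n (c : nat -> hser K) k :
  (forall j, (j <= n)%N -> puiseux (c j)) -> c 0%N != 0 -> (0 < k <= n)%N -> c k != 0 ->
  exists w, [/\ puiseux w, w != 0 & \sum_(j < n.+1) c j * w ^+ (p ^ j) = 0].
Proof.
move=> cp c0 /andP[k0 kn] ck.
have /choice [v vP] : forall j, exists m, c j != 0 -> lowest (c j) m.
  by move=> j; have [->|/lowestP[m lm]] := eqVneq (c j) 0; [exists 0|exists m].
pose q j : rat := (p ^ j)%:R - 1.
have q_gt0 j : (0 < j)%N -> 0 < q j.
  by move=> j0; rewrite subr_gt0 ltr1n -{1}(expn0 p) ltn_exp2l.
pose slope j := (v 0%N - v j) / q j.
have Pk : (fun i : 'I_n.+1 => (0 < i)%N && (c i != 0)) (Ordinal (kn : (k < n.+1)%N)).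
  by rewrite /= k0 ck.
pose j0 := [arg max_(i > Ordinal (kn : (k < n.+1)%N) | (0 < i)%N && (c i != 0))
    slope i]%O.
have [j0pos cj0 j0max] : [/\ (0 < j0)%N, c j0 != 0 &
    forall j, (0 < j <= n)%N -> c j != 0 -> slope j <= slope j0].
  rewrite /j0; case: arg_maxP => // i /andP[i0 ci] imax; split=> // j /andP[jpos jn] cj.
  by apply: (imax (Ordinal (jn : (j < n.+1)%N))); rewrite jpos.
have {}j0n : (j0 <= n)%N by rewrite -ltnS.
move: (j0 : nat) j0pos cj0 j0max j0n => {Pk j0 k0 kn ck}k k0 ck kmax kn.
pose s := slope k.
(* Coefficients after substituting w = t^s y and dividing by t^(s + v_0): all have nonnegative
   order, and those of index 0 and [k] are units. *)
pose d j := mono 1 (s * q j - v 0%N) * c j.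
have dE j i : d j i = c j (i - (s * q j - v 0%N)) by rewrite mono_mulE mul1r.
have [j jn|a a0 ad] := @puiseux_common K n.+1 d.
  by apply: puiseuxM; [apply: puiseux_mono|apply: cp].
have q00 : q 0%N = 0 by rewrite /q expn0 subrr.
have dh j : (j <= n)%N -> holomorphic a (d j).
  move=> jn i di; split; last exact: (ad j jn i di).
  move: di; rewrite dE => di.
  have cj : c j != 0 by apply: contraNneq di => ->.
  have le := (vP j cj).2 _ di.
  case: (posnP j) => [e0|jpos]; first by move: le; rewrite e0 q00; lra.
  have := kmax j; rewrite jpos jn => /(_ isT cj).
  rewrite -/s {1}/slope ler_pdivrMr ?q_gt0//; lra.
have d00 : d 0%N 0 != 0.
  by rewrite dE q00 mulr0 sub0r opprB subr0; case: (vP _ c0).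
have dk0 : d k 0 != 0.
  rewrite dE /s /slope divfK ?gt_eqF ?q_gt0//.
  have -> : 0 - (v 0%N - v k - v 0%N) = v k by ring.
  by case: (vP _ ck).
have [|y [yh y0 yE]] := hensel_root charK a0 dh d00 _ dk0; first by rewrite k0.
exists (mono 1 s * y); split.
- by apply: puiseuxM; [apply: puiseux_mono|exists a => // i /yh[]].
- by rewrite mulf_neq0// mono_eq0 oner_neq0.
transitivity (mono 1 (s + v 0%N) * \sum_(j < n.+1) d j * y ^+ (p ^ j));
    last by rewrite yE mulr0.
rewrite mulr_sumr; apply: eq_bigr => j _.
have E : mono 1 s ^+ (p ^ j) = mono 1 (s + v 0%N) * mono 1 (s * q j - v 0%N) :> hser K.
  rewrite monoX expr1n monoM mulr1 -mulr_natr /q.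
  by move: ((p ^ j)%:R : rat) => P; congr (mono _ _); ring.
rewrite exprMn E /d; move: (mono 1 _) (mono 1 _) (y ^+ _) (c j) => A B Y C.
by rewrite mulrCA -!mulrA; congr (_ * _); rewrite mulrCA.
Qed.

(** The n+1 powers x^(p^j) with j <= n lie in the span of the n powers 1, ..., x^(n-1) over Puiseux
    series, so [elimination] finds a relation. *)
Lemma integral_additive x : integral_over (@Klaurent K) x ->
  exists n (u : nat -> hser K), [/\ forall j, puiseux (u j),
    exists2 j, (j <= n)%N & u j != 0 & \sum_(j < n.+1) u j * x ^+ (p ^ j) = 0].
Proof.
case=> _ [n [a [aP aE]]].
pose b k := Hser (aP k).1.
have bp k : puiseux (b k).
  by exists 1%N => // i; rewrite mul1r; apply: (aP k).2.
have bE : \sum_(k < n) b k * x ^+ k = - x ^+ n.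
  apply: hserP => i; rewrite hco_sum_hadd hcoN hcoX -(congr1 (fun h => h i) aE).
  by congr (_ i); apply: eq_bigr => k _; rewrite hcoM hcoX.
pose Sp z := exists2 c : nat -> hser K, (forall k, puiseux (c k)) & z = \sum_(k < n)
    c k * x ^+ k.
have SpD z w : Sp z -> Sp w -> Sp (z + w).
  move=> [c cp ->] [d dp ->]; exists (fun k => c k + d k); first by move=> k; apply:
      puiseuxD.
  by rewrite -big_split; apply: eq_bigr => k _; rewrite mulrDl.
have SpM u z : puiseux u -> Sp z -> Sp (u * z).
  move=> up [c cp ->]; exists (fun k => u * c k); first by move=> k; apply: puiseuxM.
  by rewrite mulr_sumr; apply: eq_bigr => k _; rewrite mulrA.
have Sp0 : Sp 0.
  by exists (fun=> 0) => [k|]; [apply: puiseux0|rewrite big1// => k _; rewrite mul0r].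
have SpX k : (k <= n)%N -> Sp (x ^+ k).
  rewrite leq_eqVlt => /orP[/eqP->|kn].
    have -> : x ^+ n = - 1 * \sum_(k < n) b k * x ^+ k by rewrite bE mulN1r opprK.
    apply: SpM; first exact/puiseuxN/puiseux1.
    exists (fun k => if insub k is Some i then b i else 0) => [j|].
      by case: insub => [i|]; [apply: bp|apply: puiseux0].
    by apply: eq_bigr => j _; rewrite valK.
  exists (fun j => (j == k)%:R) => [j|].
    by case: (j == k); [apply: puiseux1|apply: puiseux0].
  rewrite (bigD1 (Ordinal kn))//= eqxx mul1r big1 ?addr0// => j jk.
  by move: jk; rewrite -val_eqE => /negPf /= ->; rewrite mul0r.
have SpXn m : Sp (x ^+ m).
  elim: m => [|m [c cp xm]]; first exact: SpX.
  rewrite exprS xm mulr_sumr.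
  elim/big_ind: _ => // k _; rewrite mulrCA -exprS; apply: SpM => //.
  exact: SpX.
have /choice [C CP] : forall j, exists c : nat -> hser K,
    (forall k, puiseux (c k)) /\ x ^+ (p ^ j) = \sum_(k < n) c k * x ^+ k.
  by move=> j; have [c cp xc] := SpXn (p ^ j)%N; exists c.
have [|||||| u [up _ [t ut] uE]] := @elimination (hser K) (@puiseux K) _ n
  [set: 'I_n.+1] (fun t k => C t k).
- exact: puiseux0.
- exact: puiseux1.
- by move=> y z py pz; apply: puiseuxD => //; apply: puiseuxN.
- exact: puiseuxM.
- by rewrite cardsT card_ord.
- by move=> j k; apply: (CP j).1.
exists n, (fun j => if insub j is Some i then u i else 0); split.
- by move=> j; case: insub => [i|]; [apply: up|apply: puiseux0].
- by exists t; [rewrite -ltnS|rewrite valK].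
under eq_bigr => j _ do rewrite valK (CP j).2 mulr_sumr.
rewrite exchange_big big1// => k _.
under eq_bigr => j _ do rewrite mulrA.
by rewrite -mulr_suml uE ?mul0r.
Qed.

(** Vanishing top coefficients are dropped; dividing by the first nonzero one from the top gives a
    monic equation. If only c_0 remains, x = 0. *)
Lemma additive_integral n (c : nat -> {poly K}) x :
  (exists2 j, (j <= n)%N & c j != 0) ->
  \sum_(j < n.+1) polyser (c j) * x ^+ (p ^ j) = 0 ->
  integral_over (@Kt K) x.
Proof.
elim: n => [|n IH] [j jn cj] cE.
  split; first exact: hcoP.
  move: jn cj cE; rewrite leqn0 => /eqP-> c0.
  rewrite big_ord1 expn0 expr1 => /eqP; rewrite mulf_eq0 polyser_eq0 (negPf c0) /= =>
      /eqP ->.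
  exists 1%N, (fun=> 0 : hser K); split.
    move=> _; split; first exact: hcoP.
    exists 0, 1; rewrite oner_neq0; split=> //.
    by rewrite -[polyH 1]/(hco (polyser 1)) -hcoM mul0r -polyser0.
  rewrite big_ord_recl big_ord0; apply: funext => i.
  by rewrite -!hcoX expr1 expr0 /hadd -hcoM mulr1 hco0 oppr0 addr0.
have [cn0|cn0] := eqVneq (c n.+1) 0.
  apply: IH; last by move: cE; rewrite big_ord_recr /= cn0 polyser0 mul0r addr0.
  exists j => //; move: jn; rewrite leq_eqVlt => /orP[/eqP ej|//].
  by rewrite ej cn0 eqxx in cj.
split; first exact: hcoP.
have [|w _ cw] := @puiseux_inv K (polyser (c n.+1)) (@puiseux_polyser _).
  by rewrite polyser_eq0.
(* The additive relation rewritten as an ordinary polynomial of degree p^(n+1): [b k] is zero unless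
   [k] is a power of p. *)
pose b (k : nat) := \sum_(j < n.+1 | k == (p ^ j)%N) c j.
exists (p ^ n.+1)%N, (fun k : 'I_(p ^ n.+1) => hco (w * polyser (b k))); split.
  move=> k; split; first exact: hcoP.
  exists (b k), (c n.+1); split=> //.
  rewrite -[polyH _]/(hco (polyser (c n.+1))) -hcoM.
  by rewrite mulrAC [w * _]mulrC cw mul1r.
have psum I (r : seq I) P (F : I -> {poly K}) :
    polyser (\sum_(i <- r | P i) F i) = \sum_(i <- r | P i) polyser (F i).
  by apply: big_morph; [apply: polyserD|apply: polyser0].
apply: funext => i; rewrite -hcoX -hcoN.
under eq_bigr => k _ do rewrite -hcoX -hcoM.
rewrite -hco_sum_hadd; congr (hco _ i).
move: cE; rewrite big_ord_recr /= => /eqP; rewrite addr_eq0 => /eqP cE.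
transitivity (w * \sum_(j < n.+1) polyser (c j) * x ^+ (p ^ j)); last first.
  by rewrite cE mulrN mulrA [w * _]mulrC cw mul1r.
rewrite mulr_sumr; under eq_bigr => k _ do rewrite psum mulr_sumr mulr_suml big_mkcond.
rewrite exchange_big; apply: eq_bigr => l _ /=.
have pl : (p ^ l < p ^ n.+1)%N by rewrite ltn_exp2l.
rewrite (bigD1 (Ordinal pl))//= eqxx big1 ?addr0 ?mulrA// => k kl.
by case: eqP => // ek; move: kl; rewrite -val_eqE /= ek eqxx.
Qed.

End Additive.

(** * Frobenius-stable modules *)

Definition padic (p : nat) (i : rat) := exists n, i * (p ^ n)%:R \is a Num.int.

Section FrobeniusModules.
Variable K : closedFieldType.
Variable p : nat.
Hypothesis charK : p \in [pchar K].
Let p_pr := pcharf_prime charK.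
Let p_gt0 := prime_gt0 p_pr.
Let p_gt1 := prime_gt1 p_pr.
Let pQ_gt0 : 0 < (p%:R : rat). Proof. by rewrite ltr0n. Qed.
Let pQ_neq0 : (p%:R : rat) != 0. Proof. by rewrite gt_eqF. Qed.
Implicit Types (x y z : rat -> K) (a b : nat).

Lemma padic_divp i : padic p (i * p%:R) -> padic p i.
Proof. by move=> [n h]; exists n.+1; rewrite expnS natrM mulrA. Qed.

Lemma padicMn i b : padic p i -> padic p (b%:R * i).
Proof. by move=> [n h]; exists n; rewrite -mulrA rpredM// rpred_nat. Qed.

Lemma pthroot_exists (c : K) : exists d, d ^+ p = c.
Proof.
have [|d rd] := @closed_rootP K ('X^p - c%:P) _.
  by rewrite size_XnsubC// eqSS -lt0n.
by exists d; move: rd; rewrite /root !hornerE subr_eq0 => /eqP.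
Qed.
Definition pthroot c : K := projT1 (cid (pthroot_exists c)).

Lemma pthrootK c : pthroot c ^+ p = c.
Proof. exact: projT2 (cid (pthroot_exists c)). Qed.

Lemma pcharD (c d : K) : (c + d) ^+ p = c ^+ p + d ^+ p.
Proof. by have := pchar_expD charK c d 1; rewrite expn1. Qed.

Lemma pchar_sum I (r : seq I) (P : pred I) (F : I -> K) :
  (\sum_(i <- r | P i) F i) ^+ p = \sum_(i <- r | P i) F i ^+ p.
Proof. by have := pchar_exp_sum charK r P F 1; rewrite expn1. Qed.

Lemma frob_inj : injective (fun c : K => c ^+ p).
Proof.
move=> c d /eqP cd; apply/eqP; rewrite -subr_eq0.
have : (c - d + d) ^+ p == d ^+ p by rewrite subrK.
by rewrite pcharD -subr_eq0 addrK expf_eq0 p_gt0.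
Qed.

Lemma frobK c : pthroot (c ^+ p) = c.
Proof. by apply: frob_inj; rewrite /= pthrootK. Qed.

Lemma pthroot_eq0 c : (pthroot c == 0) = (c == 0).
Proof. by rewrite -{2}(pthrootK c) expf_eq0 p_gt0. Qed.

Lemma pthrootM c d : pthroot (c * d) = pthroot c * pthroot d.
Proof. by apply: frob_inj; rewrite /= exprMn !pthrootK. Qed.

Lemma pthroot_sum I (r : seq I) (P : pred I) (F : I -> K) :
  pthroot (\sum_(i <- r | P i) F i) = \sum_(i <- r | P i) pthroot (F i).
Proof.
apply: frob_inj; rewrite /= pthrootK pchar_sum.
by apply: eq_bigr => i _; rewrite pthrootK.
Qed.

(** The p-th power map read on coefficients (see [Frob_hser]). It makes sense for arbitrary
    functions, where it is bijective with inverse [Froot]. *)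
Definition Frob x : rat -> K := fun i => x (i / p%:R) ^+ p.
Definition Froot x : rat -> K := fun i => pthroot (x (i * p%:R)).

Lemma FrobK x : Froot (Frob x) = x.
Proof. by apply: funext => i; rewrite /Froot /Frob mulfK// frobK. Qed.

Lemma FrootK x : Frob (Froot x) = x.
Proof. by apply: funext => i; rewrite /Froot /Frob mulfVK// pthrootK. Qed.

(* Finite combinations of translates: the module generated by the v k over the
   group algebra of (1/a)Z. *)
Definition tspan (I : Type) a (v : I -> rat -> K) x :=
  exists l : seq (K * int * I),
    forall i, x i = \sum_(e <- l) e.1.1 * v e.2 (i - e.1.2%:~R / a%:R).

Section Span.
Variables (I : Type) (a : nat) (v : I -> rat -> K).

Lemma tspan0 : tspan a v (fun=> 0).
Proof. by exists [::] => i; rewrite big_nil. Qed.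

Lemma tspan_gen k : tspan a v (v k).
Proof. by exists [:: (1, 0, k)] => i; rewrite big_seq1 /= mul1r mul0r subr0. Qed.

Lemma tspanD x y : tspan a v x -> tspan a v y -> tspan a v (fun i => x i + y i).
Proof.
by move=> [l xl] [m ym]; exists (l ++ m) => i; rewrite big_cat /= xl ym.
Qed.

Lemma tspan_sum J (r : seq J) (F : J -> rat -> K) :
  (forall j, tspan a v (F j)) -> tspan a v (fun i => \sum_(j <- r) F j i).
Proof.
move=> FP; elim: r => [|j r IH].
  by under eq_fun => i do rewrite big_nil; apply: tspan0.
by under eq_fun => i do rewrite big_cons; apply: tspanD.
Qed.

Lemma tspanZ c x : tspan a v x -> tspan a v (fun i => c * x i).
Proof.
move=> [l xl]; exists [seq (c * e.1.1, e.1.2, e.2) | e <- l] => i.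
by rewrite xl mulr_sumr big_map; apply: eq_bigr => e _; rewrite mulrA.
Qed.

Lemma tspan_shift (n : int) x : tspan a v x -> tspan a v (fun i => x (i - n%:~R / a%:R)).
Proof.
move=> [l xl]; exists [seq (e.1.1, e.1.2 + n, e.2) | e <- l] => i.
rewrite xl big_map; apply: eq_bigr => e _ /=; congr (_ * v _ _).
by rewrite rmorphD /= mulrDl; ring.
Qed.

End Span.

Lemma tspan_trans I J a (v : I -> rat -> K) (w : J -> rat -> K) x :
  (forall k, tspan a w (v k)) -> tspan a v x -> tspan a w x.
Proof.
move=> vw [l xl]; have -> : x = fun i => \sum_(e <- l)
    e.1.1 * v e.2 (i - e.1.2%:~R / a%:R).
  exact: funext.
by apply: tspan_sum => e; apply: tspanZ; apply: tspan_shift.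
Qed.

Lemma tspan_refine I a b (v : I -> rat -> K) x : (0 < b)%N ->
  tspan a v x -> tspan (a * b) v x.
Proof.
move=> b0 [l xl]; exists [seq (e.1.1, e.1.2 * b%:Z, e.2) | e <- l] => i.
rewrite xl big_map; apply: eq_bigr => e _ /=; congr (_ * v _ (_ - _)).
by rewrite rmorphM /= natrM -pmulrn -mulf_div divff ?mulr1// pnatr_eq0 -lt0n.
Qed.

Lemma tspan_Frob I a (v : I -> rat -> K) x :
  tspan a v x -> tspan a (fun k => Frob (v k)) (Frob x).
Proof.
move=> [l xl]; exists [seq (e.1.1 ^+ p, e.1.2 * p%:Z, e.2) | e <- l] => i.
rewrite /Frob xl pchar_sum big_map; apply: eq_bigr => e _ /=.
rewrite exprMn; congr (_ * v _ _ ^+ _).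
by rewrite rmorphM /= -pmulrn mulrBl mulrAC mulfK.
Qed.

Lemma tspan_Froot I a (v : I -> rat -> K) x :
  tspan a v x -> tspan (a * p) (fun k => Froot (v k)) (Froot x).
Proof.
move=> [l xl]; exists [seq (pthroot e.1.1, e.1.2, e.2) | e <- l] => i.
rewrite /Froot xl pthroot_sum big_map; apply: eq_bigr => e _ /=.
rewrite pthrootM; congr (_ * pthroot (v _ _)).
by rewrite mulrBl natrM invfM mulrA mulfVK.
Qed.

Definition tame_supp a (B : nat) x :=
  forall i, x i != 0 -> `|i| <= B%:R /\ padic p (a%:R * i).

(** The generators are plain functions, not assumed to be Hahn series. One denominator [a] serves
    both the translations and the supports; it can be refined, which is how two modules are brought
    together. *)
Definition frobenius_finite x := exists a B (I : finType) (v : I -> rat -> K),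
  [/\ (0 < a)%N, forall k, tame_supp a B (v k),
      forall k, tspan a v (Frob (v k)) & tspan a v x].

Lemma tame_suppW a b B C x : (B <= C)%N -> tame_supp a B x -> tame_supp (a * b) C x.
Proof.
move=> BC xa i /xa[iB ai]; split; first by rewrite (le_trans iB)// ler_nat.
by rewrite natrM mulrAC mulrC; apply: padicMn.
Qed.

Lemma frobenius_finite_refine x b : (0 < b)%N -> frobenius_finite x ->
  exists a B (I : finType) (v : I -> rat -> K),
  [/\ (0 < a)%N, (b %| a)%N, forall k, tame_supp a B (v k),
      forall k, tspan a v (Frob (v k)) & tspan a v x].
Proof.
move=> b0 [a [B [I [v [a0 vs vF xv]]]]]; exists (a * b)%N, B, I, v; split.
- by rewrite muln_gt0 a0.
- exact: dvdn_mull.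
- by move=> k; apply: tame_suppW (vs k).
- by move=> k; apply: tspan_refine.
- exact: tspan_refine.
Qed.

Lemma tame_supp_span (I : Type) a B (v : I -> rat -> K) x : (0 < a)%N ->
  (forall k, tame_supp a B (v k)) -> tspan a v x -> exists C, tame_supp a C x.
Proof.
move=> a0 vs [l xl]; pose M := (\sum_(e <- l) `|e.1.2|)%N.
exists (B + M)%N => i.
rewrite xl => xi.
have [e el ei] : exists2 e, List.In e l & v e.2 (i - e.1.2%:~R / a%:R) != 0.
  elim: l xi {xl M} => [|e l IH]; first by rewrite big_nil eqxx.
  rewrite big_cons; have [e0|e0] := eqVneq (v e.2 (i - e.1.2%:~R / a%:R)) 0.
    by rewrite e0 mulr0 add0r => /IH [f fl fi]; exists f => //; right.
  by exists e => //; left.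
have [iB [n an]] := vs _ _ ei; split.
  have eM : (`|e.1.2| <= M)%N.
    rewrite /M; elim: l el {xl xi M} => [//|f l IH] /=; rewrite big_cons.
    case=> [->|/IH le]; first exact: leq_addr.
    exact: leq_trans le (leq_addl _ _).
  rewrite -[i](subrK (e.1.2%:~R / a%:R)) natrD.
  apply: le_trans (ler_normD _ _) _; apply: lerD => //.
  have a0R : 0 < (a%:R : rat) by rewrite ltr0n.
  rewrite normrM normfV [`|a%:R|]gtr0_norm// ler_pdivrMr//.
  rewrite -intr_norm -abszE -pmulrn -natrM ler_nat (leq_trans eM)// leq_pmulr//.
exists n.
have -> : a%:R * i * (p ^ n)%:R =
    a%:R * (i - e.1.2%:~R / a%:R) * (p ^ n)%:R + e.1.2%:~R * (p ^ n)%:R.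
  move: ((p ^ n)%:R : rat) => P; field; by rewrite pnatr_eq0 -lt0n.
by rewrite rpredD// rpredM ?rpred_int ?rpred_nat.
Qed.

Lemma frobenius_finite_supp x : frobenius_finite x ->
  exists a B, (0 < a)%N /\ tame_supp a B x.
Proof.
case=> a [B [I [v [a0 vs _ xv]]]].
by have [C xC] := tame_supp_span a0 vs xv; exists a, C.
Qed.

Lemma frobenius_finiteD x y : frobenius_finite x -> frobenius_finite y ->
  frobenius_finite (fun i => x i + y i).
Proof.
move=> [a [B [I [v [a0 vs vF xv]]]]] [b [C [J [w [b0 ws wF yw]]]]].
pose u (k : I + J) := match k with inl k => v k | inr k => w k end.
have ul z : tspan a v z -> tspan (a * b) u z.
  move=> /(tspan_refine b0); apply: tspan_trans => k.
  exact: (tspan_gen _ u (inl k)).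
have ur z : tspan b w z -> tspan (a * b) u z.
  rewrite mulnC => /(tspan_refine a0); apply: tspan_trans => k.
  exact: (tspan_gen _ u (inr k)).
exists (a * b)%N, (B + C)%N, (I + J)%type, u; split.
- by rewrite muln_gt0 a0.
- case=> k; first exact: tame_suppW (leq_addr _ _) (vs k).
  by rewrite mulnC; apply: tame_suppW (leq_addl _ _) (ws k).
- by case=> k; [apply: (ul _ (vF k))|apply: (ur _ (wF k))].
- by apply: tspanD; [apply: (ul _ xv)|apply: (ur _ yw)].
Qed.

Lemma frobenius_finiteZ c x : frobenius_finite x -> frobenius_finite (fun i => c * x i).
Proof.
move=> [a [B [I [v [a0 vs vF xv]]]]]; exists a, B, I, v; split=> //.
exact: tspanZ.
Qed.

Lemma frobenius_finite_shift q x : frobenius_finite x ->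
  frobenius_finite (fun i => x (i - q)).
Proof.
have d0 : (0 < `|denq q|)%N by rewrite absz_gt0 denq_neq0.
move=> /(frobenius_finite_refine d0) [a [B [I [v [a0 /dvdnP[m am] vs vF xv]]]]].
exists a, B, I, v; split=> //.
have -> : q = (numq q * m%:Z)%:~R / a%:R; last exact: tspan_shift.
rewrite am rmorphM /= natrM natr_absz ger0_norm ?denq_ge0// -pmulrn.
have m0 : (m%:R : rat) != 0 by rewrite pnatr_eq0; apply: contraTneq a0 => m0;
    rewrite am m0.
rewrite [m%:R * _]mulrC -mulf_div divff// mulr1; exact/esym/divq_num_den.
Qed.

Lemma frobenius_finite_delta : frobenius_finite (fun i => (i == 0)%:R).
Proof.
exists 1%N, 0%N, unit, (fun _ i => (i == 0)%:R); split=> //.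
- move=> _ i; case: (i =P 0) => [->|]; rewrite ?eqxx// normr0.
  by split=> //; exists 0%N; rewrite mulr0 mul0r.
- move=> _; have -> : Frob (fun i => (i == 0)%:R) = fun i => (i == 0)%:R.
    apply: funext => i; rewrite /Frob mulf_eq0 invr_eq0 (negPf pQ_neq0) orbF.
    by case: (i == 0); rewrite ?expr1n// expr0n gtn_eqF.
  exact: (tspan_gen _ _ tt).
exact: (tspan_gen _ _ tt).
Qed.

Lemma frobenius_finite0 : frobenius_finite (fun=> 0).
Proof.
have := frobenius_finiteZ 0 frobenius_finite_delta.
by under eq_fun => i do rewrite mul0r.
Qed.

Lemma frobenius_finite_sum J (r : seq J) (F : J -> rat -> K) :
  (forall j, frobenius_finite (F j)) -> frobenius_finite (fun i => \sum_(j <- r) F j i).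
Proof.
move=> FP; elim: r => [|j r IH].
  by under eq_fun => i do rewrite big_nil; apply: frobenius_finite0.
by under eq_fun => i do rewrite big_cons; apply: frobenius_finiteD.
Qed.

Lemma frobenius_finite_Frob x : frobenius_finite x -> frobenius_finite (Frob x).
Proof.
move=> [a [B [I [v [a0 vs vF xv]]]]]; exists a, B, I, v; split=> //.
by apply: tspan_trans (tspan_Frob xv).
Qed.

(** Frobenius maps [Froot (v k)] to [v k], which is also the root of [Frob (v k)]; taking roots in
    the expansion of the latter puts it in the span of the [Froot (v k)], now with translations in
    (1/(ap))Z. *)
Lemma frobenius_finite_Froot x : frobenius_finite x -> frobenius_finite (Froot x).
Proof.
move=> [a [B [I [v [a0 vs vF xv]]]]].
exists (a * p)%N, B, I, (fun k => Froot (v k)); split.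
- by rewrite muln_gt0 a0.
- move=> k i; rewrite /Froot pthroot_eq0 => /vs[iB ai]; split.
    apply: le_trans iB; rewrite normrM ler_peMr// gtr0_norm// ler1n//.
  by move: ai; rewrite natrM mulrA mulrAC.
- by move=> k; rewrite FrootK -[X in tspan _ _ X]FrobK; apply: tspan_Froot.
- exact: tspan_Froot.
Qed.

(** Adjoining [y] to the generators for [x] keeps the module stable, since the image of [y] is
    [y + x]. Only the support of [y] has to be controlled. *)
Lemma frobenius_finite_artin_schreier x y a B : frobenius_finite x ->
  (0 < a)%N -> tame_supp a B y -> Frob y = (fun i => y i + x i) -> frobenius_finite y.
Proof.
move=> [b [C [J [v [b0 vs vF xv]]]]] a0 yt yE.
pose u (k : option J) := if k is Some k then v k else y.
have ur z : tspan b v z -> tspan (b * a) u z.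
  move=> /(tspan_refine a0); apply: tspan_trans => k.
  exact: (tspan_gen _ u (Some k)).
exists (b * a)%N, (B + C)%N, (option J), u; split.
- by rewrite muln_gt0 b0.
- case=> [k|]; first exact: tame_suppW (leq_addl _ _) (vs k).
  by rewrite mulnC; apply: tame_suppW (leq_addr _ _) yt.
- case=> [k|]; first exact: (ur _ (vF k)).
  by rewrite /= yE; apply: tspanD; [apply: (tspan_gen _ u None)|apply: (ur _ xv)].
- exact: (tspan_gen _ u None).
Qed.

(** General initial segments, so that truncations at real numbers and the set of negative rationals
    are covered, and translation and scaling by p stay inside the class. *)
Definition cut (C : rat -> bool) : Prop :=
  (forall i j, i <= j -> C j -> C i) /\ exists u, forall i, C i -> i <= u.

Definition restr (C : rat -> bool) x : rat -> K := fun i => if C i then x i else 0.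

Definition tame_cuts x := forall C, cut C -> frobenius_finite (restr C x).

Lemma cut_shift C q : cut C -> cut (fun i => C (i + q)).
Proof.
move=> [Cd [u Cu]]; split=> [i j ij|]; first by apply: Cd; rewrite lerD2r.
by exists (u - q) => i /Cu; lra.
Qed.

Lemma cut_divp C : cut C -> cut (fun i => C (i / p%:R)).
Proof.
move=> [Cd [u Cu]]; split=> [i j ij|]; first by apply: Cd; rewrite ler_pM2r ?invr_gt0.
by exists (u * p%:R) => i /Cu; rewrite ler_pdivrMr.
Qed.

Lemma cut_mulp C : cut C -> cut (fun i => C (i * p%:R)).
Proof.
move=> [Cd [u Cu]]; split=> [i j ij|]; first by apply: Cd; rewrite ler_pM2r.
by exists (u / p%:R) => i /Cu; rewrite ler_pdivlMr.
Qed.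

Lemma Frob_restr C x : Frob (restr C x) = restr (fun i => C (i / p%:R)) (Frob x).
Proof.
apply: funext => i; rewrite /Frob /restr; case: (C _) => //.
by rewrite expr0n gtn_eqF.
Qed.

Lemma Frob_hser (x : hser K) : Frob x = x ^+ p :> (rat -> K).
Proof. by apply: funext => i; rewrite (hser_frobE charK). Qed.

Lemma tame_cuts0 : tame_cuts (0 : hser K).
Proof.
move=> C _; have -> : restr C (0 : hser K) = fun=> 0.
  by apply: funext => i; rewrite /restr; case: (C i).
exact: frobenius_finite0.
Qed.

(** Below a cut the product is a finite sum of translates of restrictions of [x]: the exponents of
    [w] are discrete and bounded on both sides once [x] has a lowest term. *)
Lemma tame_cuts_puiseuxM (w x : hser K) : puiseux w -> tame_cuts x -> tame_cuts (w * x).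
Proof.
move=> [a a0 wa] xt.
have [->|w0] := eqVneq w 0; first by rewrite mul0r; apply: tame_cuts0.
have [->|x0] := eqVneq x 0; first by rewrite mulr0; apply: tame_cuts0.
have [m lw] := lowestP w0; have [n lx] := lowestP x0.
move=> C cC; have [Cd [u Cu]] := cC.
have a0R : 0 < (a%:R : rat) by rewrite ltr0n.
(* A contributing exponent of [w] lies between [m] and [u - n] on the grid m + (1/a)N; [N] bounds
   the number of grid points in that interval. *)
pose N := Num.bound `|a%:R * (u - n - m)|.
pose s := [seq m + (k%:R : rat) / a%:R | k <- iota 0 N].
have us : uniq s.
  rewrite map_inj_uniq ?iota_uniq// => j k /addrI /(divIf (lt0r_neq0 a0R)) /eqP.
  by rewrite eqr_nat => /eqP.
have -> : restr C (w * x) =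
    fun i => \sum_(k <- s) w k * restr (fun i => C (i + k)) x (i - k).
  apply: funext => i; rewrite /restr; case: ifPn => Ci; last first.
    by rewrite big1// => k _; rewrite subrK (negPf Ci) mulr0.
  rewrite hcoM (@hmul_seq _ _ _ _ s)//.
    by apply: eq_bigr => k _; rewrite subrK Ci.
  move=> k wk xk; have mk := lw.2 _ wk; have nk := lx.2 _ xk; have iu := Cu _ Ci.
  have /natrP [c ec] : a%:R * k - a%:R * m \is a Num.nat.
    rewrite natrEint rpredB ?wa//; last by case: lw.
    by rewrite subr_ge0 ler_pM2l.
  apply/mapP; exists c; last first.
    by rewrite -ec; field; rewrite pnatr_eq0 -lt0n.
  rewrite mem_iota /= add0n -(ltr_nat rat) -ec.
  apply: le_lt_trans (archi_boundP (normr_ge0 _)); apply: le_trans (ler_norm _).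
  by rewrite -mulrBr ler_pM2l//; lra.
apply: frobenius_finite_sum => k; apply: frobenius_finiteZ.
apply: (@frobenius_finite_shift k (restr (fun i => C (i + k)) x)).
by apply: xt; apply: cut_shift.
Qed.

Lemma tame_cuts_frob (x : hser K) j : tame_cuts (x ^+ (p ^ j)) -> tame_cuts x.
Proof.
elim: j => [|j IH]; first by rewrite expr1.
rewrite expnSr exprM => xt; apply: IH => C cC.
rewrite -[restr _ _]FrobK; apply: frobenius_finite_Froot.
by rewrite Frob_restr Frob_hser; apply: xt; apply: cut_divp.
Qed.

Lemma pexpn_large (B : rat) : exists n, B < (p ^ n)%:R.
Proof.
exists (Num.bound `|B|); apply: le_lt_trans (ler_norm _) _.
apply: lt_trans (archi_boundP (normr_ge0 _)) _.
by rewrite ltr_nat ltn_expl.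
Qed.

(* Frobenius carries the restriction of y to C to its restriction to pC, up to
   a restriction of y^p - y. Iterating pushes a cut bounded by a negative number
   below the support of y, and shrinks a cut containing 0 until no positive
   exponent of y is left; the cut of all negative exponents is fixed. *)
Lemma tame_cuts_artin_schreier (y : hser K) : tame_cuts (y ^+ p - y) -> tame_cuts y.
Proof.
move=> zt; pose z := y ^+ p - y.
have [->|y0] := eqVneq y 0; first exact: tame_cuts0.
have [m ly] := lowestP y0.
have yE C : Frob (restr C y) =
    fun i => restr (fun i => C (i / p%:R)) y i + restr (fun i => C (i / p%:R)) z i.
  rewrite Frob_restr Frob_hser; apply: funext => i; rewrite /restr.
  by case: (C _); rewrite ?addr0// /z hcoB addrC subrK.
pose A C := frobenius_finite (restr C y).
have down C : cut C -> A (fun i => C (i / p%:R)) -> A C.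
  move=> cC AC; rewrite /A -[restr C y]FrobK; apply: frobenius_finite_Froot.
  by rewrite yE; apply: frobenius_finiteD => //; apply: zt; apply: cut_divp.
have up C : cut C -> A C -> A (fun i => C (i / p%:R)).
  move=> cC AC; rewrite /A.
  have -> : restr (fun i => C (i / p%:R)) y =
      fun i => Frob (restr C y) i + -1 * restr (fun i => C (i / p%:R)) z i.
    by rewrite yE; apply: funext => i; rewrite mulN1r addrK.
  apply: frobenius_finiteD; first exact: frobenius_finite_Frob.
  by apply: frobenius_finiteZ; apply: zt; apply: cut_divp.
have below n : forall C, cut C -> (forall i, C i -> i * (p ^ n)%:R < m) -> A C.
  elim: n => [|n IH] C cC Cm.
    rewrite /A; have -> : restr C y = fun=> 0; last exact: frobenius_finite0.
    apply: funext => i; rewrite /restr; case: ifP => // /Cm.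
    by rewrite mulr1; apply: lowest_lt.
  apply: down => //; apply: IH => [|i /Cm]; first exact: cut_divp.
  by rewrite expnS natrM mulrA mulfVK.
have belowneg C u : cut C -> u < 0 -> (forall i, C i -> i <= u) -> A C.
  move=> cC u0 Cu; have [n nm] := pexpn_large (m / u).
  apply: (below n) => // i /Cu iu.
  have P0 : 0 < ((p ^ n)%:R : rat) by rewrite ltr0n expn_gt0 p_gt0.
  apply: (@le_lt_trans _ _ (u * (p ^ n)%:R)); first by rewrite ler_pM2r.
  by move: nm; rewrite ltr_ndivrMr// mulrC.
pose neg : rat -> bool := fun i => i < 0.
have cneg : cut neg.
  split=> [i j ij|]; first exact: le_lt_trans.
  by exists 0 => i /ltW.
have negE : (fun i => neg (i / p%:R)) = neg.
  by apply: funext => i; rewrite /neg pmulr_llt0 ?invr_gt0.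
have Aneg : A neg.
  have zneg := zt _ cneg.
  have [a [B [a0 zs]]] := frobenius_finite_supp zneg.
  (* A nonzero [y i] forces [y (i * p)] or [z (i * p)] to be nonzero. For negative [i], repeated
     multiplication by p leaves the support of [y], so some multiple of [i] by a power of p lies in
     the support of [z], whose denominators are controlled. *)
  have ypadic n i : i < 0 -> y i != 0 -> i * (p ^ n)%:R < m -> padic p (a%:R * i).
    elim: n i => [|n IH] i i0 yi.
      by rewrite mulr1 => /(lowest_lt ly) yi0; rewrite yi0 eqxx in yi.
    rewrite expnS natrM mulrA => im; apply: padic_divp; rewrite -mulrA.
    have ip0 : i * p%:R < 0 by rewrite pmulr_llt0.
    have : Frob y (i * p%:R) != 0 by rewrite /Frob mulfK// expf_eq0 negb_and yi orbT.
    have -> : Frob y (i * p%:R) = y (i * p%:R) + restr neg z (i * p%:R).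
      by rewrite Frob_hser /restr /neg ip0 hcoB addrC subrK.
    have [y0'|yip _] := eqVneq (y (i * p%:R)) 0; last exact: IH.
    by rewrite y0' add0r => /zs[].
  apply: (@frobenius_finite_artin_schreier (restr neg z) _ a (Num.bound `|m|)) => //.
    move=> i; rewrite /restr; case: ifPn => [i0 yi|]; last by rewrite eqxx.
    split.
      have mi := ly.2 _ yi; move: i0; rewrite /neg => i0; rewrite ltr0_norm//.
      have := archi_boundP (normr_ge0 m); have := ler_norm (- m); rewrite normrN; lra.
    have [n nm] := pexpn_large (m / i); apply: (ypadic n) => //.
    by move: nm; rewrite ltr_ndivrMr// mulrC.
  by rewrite yE negE.
(* [mu] is the least positive exponent of [y], or 1 if there is none. A cut containing 0 and bounded
   by [mu] sees only the negative part and the constant term. *)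
have [mu mu0 ymu] : exists2 mu : rat, 0 < mu & forall i, 0 < i -> i < mu -> y i = 0.
  have [e|/lowestP[mu lmu]] := eqVneq (hrestr (fun i => 0 < i) y) 0.
    exists 1 => // i i0 _; have := congr1 (fun h => hco h i) e.
    by rewrite hrestrE i0 hco0.
  exists mu; first by case: lmu; rewrite hrestrE; case: ifP => // _; rewrite eqxx.
  by move=> i i0 /(lowest_lt lmu); rewrite hrestrE i0.
have above n : forall C, cut C -> C 0 -> (forall i, C i -> i < mu * (p ^ n)%:R) -> A C.
  elim: n => [|n IH] C cC C0 Cmu.
    rewrite /A; have -> : restr C y = fun i => restr neg y i + y 0 * (i == 0)%:R.
      apply: funext => i; rewrite /restr /neg; case: (ltgtP i 0) => [i0|i0|->].
      - by rewrite (cC.1 _ _ (ltW i0) C0) mulr0 addr0.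
      - case: ifP => [/Cmu|_]; last by rewrite mulr0 addr0.
        by rewrite mulr1 => /(ymu _ i0) ->; rewrite mulr0 addr0.
      - by rewrite C0 mulr1 add0r.
    by apply: frobenius_finiteD => //; apply/frobenius_finiteZ/frobenius_finite_delta.
  have -> : C = (fun i => C (i / p%:R * p%:R)).
    by apply: funext => i; rewrite mulfVK.
  apply: (up (fun i => C (i * p%:R))); first exact: cut_mulp.
  apply: IH; [exact: cut_mulp|by rewrite mul0r|move=> i /Cmu].
  by rewrite expnSr natrM mulrA ltr_pM2r.
move=> C cC; have [Cd [u Cu]] := cC.
have [C0|nC0] := boolP (C 0).
  have [n nu] := pexpn_large (u / mu); apply: (above n) => // i /Cu iu.
  by apply: le_lt_trans iu _; rewrite mulrC -ltr_pdivrMr.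
have Cneg i : C i -> i < 0.
  by move=> Ci; rewrite ltNge; apply: contra nC0 => i0; apply: Cd Ci.
(* A cut of negative numbers without a negative upper bound is all of [neg]. *)
have [[v [v0 vC]]|no] := pselect (exists v, v < 0 /\ forall i, C i -> i <= v).
  exact: belowneg v0 vC.
suff -> : C = neg by [].
apply: funext => i; rewrite /neg; case: (ltP i 0) => i0; last first.
  by apply/negP => /Cneg; rewrite ltNge i0.
apply: contrapT => /negP nCi; apply: no; exists i; split=> // j Cj.
by rewrite leNgt; apply: contra nCi => /ltW ij; apply: Cd Cj.
Qed.

(** Dividing [y] by a Puiseux root [w] makes 1 a root of the new relation, that is, its coefficients
    [d] sum to zero; summation by parts then expresses it through u^p - u with one term fewer. *)
Lemma tame_cuts_additive n (c : nat -> hser K) (y : hser K) :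
  (forall j, (j <= n)%N -> puiseux (c j)) -> c 0%N != 0 ->
  \sum_(j < n.+1) c j * y ^+ (p ^ j) = 0 -> tame_cuts y.
Proof.
elim: n c y => [|n IH] c y cp c0 yE.
  move: yE; rewrite big_ord1 expn0 expr1 => /eqP; rewrite mulf_eq0 (negPf c0) /= =>
      /eqP->.
  exact: tame_cuts0.
have [[k [kn ck]]|no] := pselect (exists k, (0 < k <= n.+1)%N /\ c k != 0); last first.
  move: yE; rewrite big_ord_recl big1 ?addr0 => [|j _].
    rewrite expn0 expr1 => /eqP; rewrite mulf_eq0 (negPf c0) /= => /eqP->.
    exact: tame_cuts0.
  have [->|cj] := eqVneq (c (lift ord0 j)) 0; first by rewrite mul0r.
  by case: no; exists (lift ord0 j); split=> //; rewrite lift0 ltn_ord.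
have [w [wp w0 wE]] := additive_root charK cp c0 kn ck.
have [v vp wv] := puiseux_inv wp w0.
have -> : y = w * (v * y) by rewrite mulrA wv mul1r.
apply: tame_cuts_puiseuxM => //; apply: tame_cuts_artin_schreier.
pose d j := c j * w ^+ (p ^ j).
(* Negated partial sums: [q 0 = - d 0] is nonzero, as the induction requires, and [q n.+1 = 0]
   because [w] is a root. *)
pose q j := - \sum_(i < j.+1) d i.
have dp j : (j <= n.+1)%N -> puiseux (d j).
  by move=> jn; apply: puiseuxM; [apply: cp|apply: puiseuxX].
apply: (IH q).
- move=> j jn; apply/puiseuxN/puiseux_sum => i _; apply: dp.
  by apply: leqW; apply: leq_trans jn; rewrite -ltnS.
- by rewrite /q big_ord1 oppr_eq0 /d mulf_neq0// expf_neq0.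
set u := v * y; have uE : \sum_(j < n.+2) d j * u ^+ (p ^ j) = 0.
  rewrite -[RHS]yE; apply: eq_bigr => j _.
  by rewrite /d -mulrA -exprMn /u mulrA wv mul1r.
have qn : q n.+1 = 0 by rewrite /q wE oppr0.
have charH := hser_pchar charK.
have subX j : (u ^+ p - u) ^+ (p ^ j) = u ^+ (p ^ j.+1) - u ^+ (p ^ j).
  apply/eqP; rewrite eq_sym subr_eq -(pchar_expD charH) subrK.
  by rewrite -exprM -expnS.
under eq_bigr => j _ do rewrite subX mulrBr.
rewrite sumrB.
have -> : \sum_(j < n.+1) q j * u ^+ (p ^ j.+1) =
    \sum_(j < n.+2) (q j + d j) * u ^+ (p ^ j).
  have q0 : q 0%N + d 0%N = 0 by rewrite /q big_ord1 addNr.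
  rewrite [RHS]big_ord_recl q0 mul0r add0r.
  apply: eq_bigr => j _; congr (_ * _).
  by rewrite /q [in RHS]big_ord_recr /= opprD addrNK.
under eq_bigr => j _ do rewrite mulrDl.
rewrite big_split /= uE addr0 big_ord_recr /= qn mul0r addr0.
by rewrite subrr.
Qed.

(** Roots are not extracted from the coefficients: a relation whose first nonzero coefficient has
    index [j] is read as one for x^(p^j) with nonzero first coefficient, and [tame_cuts_frob]
    descends to [x]. *)
Lemma tame_cuts_integral (x : hser K) : integral_over (@Klaurent K) x -> tame_cuts x.
Proof.
case/(integral_additive p) => n [u [up [j0 j0n uj0] uE]].
have ex : exists j, u j != 0 by exists j0.
pose j := ex_minn ex.
have [uj jmin] : u j != 0 /\ forall i, u i != 0 -> (j <= i)%N.
  by rewrite /j; case: ex_minnP.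
have jn : (j <= n)%N by apply: leq_trans (jmin _ uj0) j0n.
apply: (@tame_cuts_frob x j); apply: (@tame_cuts_additive (n - j) (fun i =>
    u (i + j)%N)) => //.
rewrite -[RHS]uE -(big_mkord xpredT (fun i => u i * x ^+ (p ^ i))).
rewrite (big_cat_nat _ (n := j)) ?leqW//=.
have -> : \sum_(0 <= i < j) u i * x ^+ (p ^ i) = 0.
  rewrite big_nat big1// => i ij.
  have [->|/jmin] := eqVneq (u i) 0; first by rewrite mul0r.
  by rewrite leqNgt (proj2 (andP ij)).
rewrite add0r -[X in _ = \sum_(X <= i < _) _]add0n big_addn subSn// big_mkord; apply:
    eq_bigr => i _.
by rewrite -exprM -expnD addnC.
Qed.

End FrobeniusModules.

(** * From modules to automata *)

Lemma natr_inj_lt1 (m n : nat) : (m%:R : rat) < n%:R + 1 -> (n%:R : rat)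
    < m%:R + 1 -> m = n.
Proof.
by rewrite !natr1 !ltr_nat !ltnS => mn nm; apply/eqP; rewrite eqn_leq mn.
Qed.

Section Words.
Variable p : nat.
Hypothesis p_gt1 : (1 < p)%N.
Let p_gt0 : (0 < p)%N := ltnW p_gt1.
Let pQ_gt0 : 0 < (p%:R : rat). Proof. by rewrite ltr0n. Qed.
Implicit Types (s : seq 'I_p) (d : 'I_p).

Definition ival s : nat := foldl (fun acc d => acc * p + d)%N 0%N s.
Definition fval s : rat := foldr (fun d acc => ((nat_of_ord d)%:R + acc) / p%:R) 0 s.

Lemma ival_rcons s d : ival (rcons s d) = (ival s * p + d)%N.
Proof. by rewrite /ival foldl_rcons. Qed.

Lemma LvalE w : Lval w = (ival w.1)%:R + fval w.2.
Proof.
rewrite /Lval; congr (_ + _); elim/last_ind: w.1 => [//|s d IH].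
by rewrite foldl_rcons IH ival_rcons natrD natrM.
Qed.

Lemma fval_ge0 s : 0 <= fval s.
Proof. by elim: s => [//|d s IH] /=; rewrite divr_ge0 ?addr_ge0. Qed.

Lemma fval_lt1 s : fval s < 1.
Proof.
elim: s => [//|d s IH] /=; rewrite ltr_pdivrMr// mul1r.
have : (d.+1%:R : rat) <= p%:R by rewrite ler_nat.
by rewrite -natr1; lra.
Qed.

(** A crude bound, enough to turn a bound on the support into a bound on the number of integer
    digits. *)
Lemma size_ival s : Lp0 s -> (size s <= ival s)%N.
Proof.
elim/last_ind: s => [//|s d IH]; rewrite size_rcons ival_rcons.
case: s IH => [|e s] IH /=; first by rewrite /ival /= -lt0n mul0n.
by move=> /IH /=; nia.
Qed.

Lemma ZpinvNonnegP i : ZpinvNonneg p i <-> 0 <= i /\ padic p i.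
Proof.
have pkE k : (p ^ k)%:R = ((p ^ k)%:Z)%:~R :> rat by rewrite -pmulrn.
split=> [[i0 [k /dvdzP[m em]]]|[i0 [k ik]]]; split=> //; exists k.
  by rewrite pkE em rmorphM /= mulrCA -numqE rpredM ?rpred_int.
move: ik => /intrP[z]; rewrite pkE => ez.
rewrite -(@Gauss_dvdzr _ (numq i)); last by rewrite coprimezE coprime_sym coprime_num_den.
apply/dvdzP; exists z; apply: (@intr_inj rat).
by rewrite !rmorphM /= numqE -ez; ring.
Qed.

Let pQ_neq0 : (p%:R : rat) != 0. Proof. by rewrite gt_eqF. Qed.

Lemma Lp0_rev_cons d s :
  Lp0 (rev (d :: s)) = if s is [::] then d != 0%N :> nat else Lp0 (rev s).
Proof.
rewrite rev_cons; case: s => [//|e s]; rewrite rev_cons.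
by case: (rev s).
Qed.

Lemma fval_gt0 s : Lp0 (rev s) -> s != [::] -> 0 < fval s.
Proof.
elim: s => [//|d s IH]; rewrite Lp0_rev_cons => sv _ /=.
apply: divr_gt0 => //; case: s IH sv => [|e s] IH sv.
  by rewrite addr0 ltr0n lt0n.
by rewrite ltr_wpDl// IH.
Qed.

Lemma fval_cons_inj (d e : 'I_p) (s t : seq 'I_p) : ((d : nat)%:R + fval s) / p%:R =
    ((e : nat)%:R + fval t) / p%:R ->
  d = e /\ fval s = fval t.
Proof.
move=> /(divIf pQ_neq0) h.
have de : d = e :> nat.
  have s0 := fval_ge0 s; have s1 := fval_lt1 s.
  have t0 := fval_ge0 t; have t1 := fval_lt1 t.
  by apply: natr_inj_lt1; lra.
by split; [apply: val_inj|move: h; rewrite de => /addrI].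
Qed.

Lemma fval_inj s t : Lp0 (rev s) -> Lp0 (rev t) -> fval s = fval t -> s = t.
Proof.
elim: s t => [|d s IH] [|e t] sv tv //= st.
- by have := fval_gt0 tv isT; rewrite /= -st ltxx.
- by have := fval_gt0 sv isT; rewrite /= st ltxx.
have [-> /IH ->] // := fval_cons_inj st.
- by move: sv; rewrite Lp0_rev_cons; case: s {IH st}.
- by move: tv; rewrite Lp0_rev_cons; case: t {st}.
Qed.

Lemma fval_surj f : 0 <= f < 1 -> padic p f -> exists s, Lp0 (rev s) /\ fval s = f.
Proof.
move=> + [k]; elim: k f => [|k IH] f /andP[f0 f1].
  rewrite mulr1 => /intrP[z ez]; exists [::]; split=> //=.
  by move: f0 f1; rewrite ez ler0z ltrz1 => z0 z1; have -> : z = 0 by lia.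
set n := Num.truncn (f * p%:R); rewrite expnS natrM mulrA => fk.
have /andP[n1 n2] : n%:R <= f * p%:R < n.+1%:R.
  by apply: truncn_itv; apply: mulr_ge0 => //; apply: ltW.
have np : (n < p)%N.
  rewrite -(ltr_nat rat); apply: le_lt_trans n1 _.
  by rewrite gtr_pMl.
have [||s [sv sf]] := IH (f * p%:R - n%:R).
- by apply/andP; split; [lra|move: n2; rewrite -natr1; lra].
- by rewrite mulrBl rpredB// rpredM ?rpred_nat.
(* A zero digit before an empty tail would be a trailing zero; this happens only for f = 0,
   represented by the empty word. *)
have [/andP[/eqP s0 /eqP n0]|no] := boolP ((s == [::]) && (n == 0)%N).
  exists [::]; split=> //=; move: sf; rewrite s0 n0 /= subr0 => /esym/eqP.
  by rewrite mulf_eq0 (negPf pQ_neq0) orbF => /eqP.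
exists (Ordinal np :: s); split; last by rewrite /= sf addrC subrK mulfK.
by rewrite Lp0_rev_cons; case: s sv no {sf} => //=.
Qed.

Lemma ival_surj n : exists s, Lp0 s /\ ival s = n.
Proof.
elim/ltn_ind: n => n IH; have [->|n0] := posnP n; first by exists [::].
have [|s [sv sn]] := IH (n %/ p)%N; first by rewrite ltn_Pdiv.
have np : (n %% p < p)%N by rewrite ltn_mod.
exists (rcons s (Ordinal np)); rewrite ival_rcons sn /= -divn_eq; split=> //.
case: s sv sn => [|e s] //= _ /esym sn.
by rewrite modn_small -?lt0n//; move/eqP: sn; rewrite -leqn0 leqNgt divn_gt0// -ltnNge.
Qed.
End Words.

(** * Construction of the automaton *)

Section FrobeniusFiniteAutomatic.
Variable K : closedFieldType.
Variable p : nat.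
Hypothesis charK : p \in [pchar K].
Let p_pr := pcharf_prime charK.
Let p_gt0 := prime_gt0 p_pr.
Let p_gt1 := prime_gt1 p_pr.
Let pQ_gt0 : 0 < (p%:R : rat). Proof. by rewrite ltr0n. Qed.
Let pQ_neq0 : (p%:R : rat) != 0. Proof. by rewrite gt_eqF. Qed.
Implicit Types (x y z : rat -> K) (a b : nat).
Local Notation pthroot := (pthroot charK).

Section Coordinates.
Variable Q : finType.
Definition vcoord (u : 'rV[K]_#|Q|) q := u 0 (enum_rank q).
Definition vmake (g : Q -> K) : 'rV[K]_#|Q| := \row_i g (enum_val i).

Lemma vmakeE g q : vcoord (vmake g) q = g q.
Proof. by rewrite /vcoord mxE enum_rankK. Qed.

Lemma vcoordP u v : (forall q, vcoord u q = vcoord v q) -> u = v.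
Proof.
by move=> uv; apply/rowP => i; rewrite -(enum_valK i); apply: uv.
Qed.

Lemma vcoordD u v q : vcoord (u + v) q = vcoord u q + vcoord v q.
Proof. by rewrite /vcoord mxE. Qed.
Lemma vcoordZ c u q : vcoord (c *: u) q = c * vcoord u q.
Proof. by rewrite /vcoord mxE. Qed.
End Coordinates.

Lemma pthroot_iterM l c d :
  iter l pthroot (c * d) = iter l pthroot c * iter l pthroot d.
Proof. by elim: l => [//|l IH]; rewrite !iterS IH pthrootM. Qed.

Lemma pthroot_iter_sum l I (r : seq I) (P : pred I) (F : I -> K) :
  iter l pthroot (\sum_(i <- r | P i) F i) = \sum_(i <- r | P i) iter l pthroot (F i).
Proof. by elim: l => [//|l IH]; rewrite iterS IH pthroot_sum. Qed.

(* The state space carries, for each l, the p^l-th roots of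
   the values of h (so that reading l integer digits lands on the values
   themselves) and the integer prefix read so far; the two extra coordinates
   make iota injective and pi surjective. *)
Lemma automatic_of_family (J : finType) (h : J -> rat -> K)
    (M : 'I_p -> J -> J -> K) (N : nat) (P : nat -> J -> K) x :
  (forall (d : 'I_p) j (f : rat), 0 <= f < 1 ->
     h j (((d : nat)%:R + f) / p%:R) ^+ p = \sum_j' M d j j' * h j' f) ->
  (forall (n : nat) (f : rat), 0 <= f < 1 -> x (n%:R + f) = \sum_j P n j * h j f) ->
  (forall i, x i != 0 -> ZpinvNonneg p i /\ i < N%:R) ->
  p_automatic p x.
Proof.
move=> hM xP xN; split; first by move=> i /xN[].
(* Integer words of value below [N] have length below [N], so [L] layers are ample. *)
pose L := N.+1.
pose Q : finType := (bool + 'I_L.+1 * 'I_N.+1 * J)%type.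
pose iota c := vmake (fun q : Q => match q with
  | inl e => if e then c else 0
  | inr (l, n, j) => if n == 0%N :> nat then c * iter l pthroot (h j 0) else 0 end).
pose pi (u : 'rV[K]_#|Q|) := vcoord u (inl false) +
  \sum_(n < N) \sum_j P n j * vcoord u (inr (ord0, inord n, j)).
(* Reading [d] moves the prefix n/p to n, whose last digit is [d], and layer l+1 to layer l: the
   p-th power undoes one root. *)
pose tau1 (d : 'I_p) (u : 'rV[K]_#|Q|) := vmake (fun q : Q => match q with
  | inl e => 0
  | inr (l, n, j) => if (n %% p == d)%N && (l.+1 < L.+1)%N
      then vcoord u (inr (inord l.+1, inord (n %/ p), j)) ^+ p else 0 end).
(* The p^(l+1)-th root of the recursion [hM], acting inside layer l. *)
pose tau2 (d : 'I_p) (u : 'rV[K]_#|Q|) := vmake (fun q : Q => match q with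
  | inl e => 0
  | inr (l, n, j) => if n == 0%N :> nat
      then pthroot (\sum_j' iter l pthroot (M d j j') * vcoord u (inr (l, ord0, j')))
          else 0 end).
exists #|Q|, iota, pi, tau1, tau2, pthroot; split.
- by split=> c; [apply: pthrootK|apply: frobK].
- split=> [c u v|c d cd].
    apply: vcoordP => q; rewrite vcoordD vcoordZ !vmakeE.
    case: q => [[]|[[l n] j]]; rewrite ?mulr0 ?addr0//.
    by case: ifP => _; rewrite ?mulr0 ?addr0// mulrDl mulrA.
  by have := congr1 (fun u => vcoord u (inl true)) cd; rewrite !vmakeE.
- split=> [c u v|c].
    rewrite /pi vcoordD vcoordZ mulrDr mulr_sumr addrACA -big_split; congr (_ + _).
    apply: eq_bigr => n _; rewrite mulr_sumr -big_split; apply: eq_bigr => j _.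
    by rewrite vcoordD vcoordZ mulrDr mulrCA.
  exists (vmake (fun q : Q => if q is inl false then c else 0)).
  rewrite /pi vmakeE big1 ?addr0// => n _; apply: big1 => j _.
  by rewrite vmakeE mulr0.
- split=> d; split=> [u v|c u]; apply: vcoordP => q.
  + rewrite vcoordD !vmakeE; case: q => [e|[[l n] j]]; rewrite ?addr0//.
    by case: ifP => _; rewrite ?addr0// vcoordD (pcharD charK).
  + rewrite vcoordZ !vmakeE; case: q => [e|[[l n] j]]; rewrite ?mulr0//.
    by case: ifP => _; rewrite ?mulr0// vcoordZ exprMn.
  + rewrite vcoordD !vmakeE; case: q => [e|[[l n] j]]; rewrite ?addr0//.
    case: ifP => _; rewrite ?addr0//; apply: (frob_inj charK).
    rewrite /= (pcharD charK) !pthrootK -big_split; apply: eq_bigr => j' _.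
    by rewrite vcoordD mulrDr.
  + rewrite vcoordZ !vmakeE; case: q => [e|[[l n] j]]; rewrite ?mulr0//.
    case: ifP => _; rewrite ?mulr0// -pthrootM mulr_sumr.
    by congr pthroot; apply: eq_bigr => j' _; rewrite vcoordZ mulrCA.
case=> s1 s2 /andP[/= s1v s2v]; rewrite LvalE /=.
set f := fval s2; have f01 : 0 <= f < 1 by rewrite fval_ge0 fval_lt1.
have E2 : vcoord (composed tau2 s2 (iota 1)) (inl false) = 0 /\
    forall (l : 'I_L.+1) (n : 'I_N.+1) j, vcoord (composed tau2 s2 (iota 1)) (inr (l,
        n, j)) =
      if n == 0%N :> nat then iter l pthroot (h j f) else 0.
  rewrite /f; elim: s2 {s2v f f01} => [|d s IH] /=.
    by split=> [|l n j]; rewrite vmakeE// mul1r.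
  split=> [|l n j]; rewrite vmakeE//; case: ifP => // _.
  under eq_bigr => j' _ do rewrite IH.2 /= -pthroot_iterM.
  rewrite -pthroot_iter_sum -hM ?fval_ge0 ?fval_lt1//.
  by rewrite -iterS iterSr frobK.
have E1 : vcoord (composed tau1 (rev s1) (composed tau2 s2 (iota 1))) (inl false) = 0 /\
    forall (l : 'I_L.+1) (n : 'I_N.+1) j, vcoord (composed tau1 (rev s1)
        (composed tau2 s2 (iota 1))) (inr (l, n, j)) =
      if (n == ival s1 :> nat) && (l + size s1 < L.+1)%N then iter l pthroot (h j f)
          else 0.
  elim/last_ind: s1 {s1v} => [|s d IH].
    rewrite /= E2.1; split=> // l n j; rewrite E2.2 addn0 ltn_ord andbT.
    by [].
  rewrite rev_rcons /=; split=> [|l n j]; rewrite vmakeE//.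
  rewrite ival_rcons size_rcons.
  case: ifPn => [/andP[/eqP nd lL]|no].
    rewrite IH.2 inordK; last by rewrite ltnS (leq_trans (leq_div _ _))// -ltnS.
    rewrite inordK//.
    have -> : (n %/ p == ival s)%N = (n == (ival s * p + d)%N :> nat).
      by rewrite {2}(divn_eq n p) nd eqn_add2r eqn_pmul2r.
    rewrite addSnnS.
    case: ifP => _; last by rewrite expr0n gtn_eqF.
    by rewrite iterS pthrootK.
  case: ifPn => // /andP[/eqP en lL]; case/negP: no.
  rewrite en modnMDl modn_small// eqxx /=.
  by apply: leq_ltn_trans lL; rewrite addnS ltnS leq_addr.
rewrite /pi E1.1 add0r.
have s1L : (size s1 <= ival s1)%N := size_ival p_gt1 s1v.
have E3 (n : 'I_N) j : vcoord (composed tau1 (rev s1) (composed tau2 s2 (iota 1)))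
    (inr (ord0, inord n, j)) = if (n == ival s1 :> nat) then h j f else 0.
  rewrite E1.2 inordK; last by rewrite ltnS ltnW.
  case: eqP => //= en; rewrite add0n; suff -> : (size s1 < L.+1)%N by [].
  by rewrite /L ltnS ltnW// ltnS (leq_trans s1L)// -en ltnW.
transitivity (\sum_(n < N) \sum_j P n j * (if (n == ival s1 :> nat) then h j f else 0));
  last by apply: eq_bigr => n _; apply: eq_bigr => j _; rewrite E3.
have [nN|Nn] := ltnP (ival s1) N.
  rewrite xP// (bigD1 (Ordinal nN))//= [X in _ + X]big1 ?addr0 => [|n nn].
    by apply: eq_bigr => j _; rewrite eqxx.
  apply: big1 => j _; case: eqP => [en|_]; last by rewrite mulr0.
  by move: nn; rewrite -val_eqE /= en eqxx.
rewrite big1 => [|n _]; last first.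
  apply: big1 => j _; case: eqP => [en|_]; last by rewrite mulr0.
  by have := ltn_ord n; rewrite en ltnNge Nn.
apply/eqP/negPn/negP => /xN[_]; rewrite ltNge.
have : (N%:R : rat) <= (ival s1)%:R by rewrite ler_nat.
by case/andP: f01 => f0 _ le; case/negP; rewrite (le_trans le)// lerDl.
Qed.

(** After rescaling by [a] the translations are integral. The family consists of the generators cut
    into unit intervals, and the Frobenius expansions of the generators yield the digit
    recursion. *)
Lemma frobenius_finite_automatic x : frobenius_finite p x -> p_quasi_automatic p x.
Proof.
case=> a [B [I [v [a0 vs vF xv]]]].
have [C xC] := tame_supp_span a0 vs xv.
have a0R : 0 < (a%:R : rat) by rewrite ltr0n.
have aN0 : (a%:R : rat) != 0 by rewrite gt_eqF.
(* The rescaled support lies in [-aC, aC]; adding [b] moves it into [0, 2b]. *)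
pose b := (a * C)%N; pose N := (2 * b).+1.
have xsupp i : x i != 0 -> [/\ ZpinvNonneg p (a%:R * i + b%:R) & a%:R * i + b%:R < N%:R].
  move=> /xC[]; rewrite ler_norml => /andP[iC1 iC2] ai.
  have h1 : a%:R * - C%:R <= a%:R * i by rewrite ler_pM2l.
  have h2 : a%:R * i <= a%:R * C%:R by rewrite ler_pM2l.
  rewrite /N /b -natr1 !natrM; split; last by lra.
  apply/ZpinvNonnegP; split; first by lra.
  have [n an] := ai; exists n; rewrite mulrDl rpredD// -natrM.
  by rewrite rpredM ?rpred_nat.
exists a, b; split=> //; split.
  move=> i /xsupp[h _]; exists (a%:R * i + b%:R); split=> //.
  by rewrite addrK mulrC mulKf.
(* For f in [0,1), v_k((f + z)/a) can be nonzero only for -c <= z < c; the index n < W stands for z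
   = n - c. *)
pose c := (a * B).+1; pose W := (2 * c)%N.
pose J : finType := (I * 'I_W)%type.
pose h (j : J) (f : rat) := v j.1 ((f + j.2%:R - c%:R) / a%:R).
pose lin (F : rat -> K) := exists P : J -> K, forall f, 0 <= f < 1 -> F f =
    \sum_j P j * h j f.
have linD F G : lin F -> lin G -> lin (fun f => F f + G f).
  move=> [P FP] [P' GP]; exists (fun j => P j + P' j) => f f01.
  by rewrite FP// GP// -big_split; apply: eq_bigr => j _; rewrite mulrDl.
have linZ r F : lin F -> lin (fun f => r * F f).
  move=> [P FP]; exists (fun j => r * P j) => f f01.
  by rewrite FP// mulr_sumr; apply: eq_bigr => j _; rewrite mulrA.
have lin0 : lin (fun=> 0).
  by exists (fun=> 0) => f _; rewrite big1// => j _; rewrite mul0r.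
have lin_v k (z : int) : lin (fun f => v k ((f + z%:~R) / a%:R)).
  have [zc|zc] := boolP ((- c%:Z <= z) && (z < c%:Z)).
    have [n en] : exists n : nat, z + c%:Z = n%:Z.
      by exists (absz (z + c%:Z)); lia.
    have nW : (n < W)%N by rewrite /W; lia.
    exists (fun j => (j == (k, Ordinal nW))%:R) => f f01.
    rewrite (bigD1 (k, Ordinal nW))//= eqxx mul1r big1 ?addr0 => [|j /negPf ->];
        last first.
      by rewrite mul0r.
    rewrite /h /=; have -> : n%:R = z%:~R + c%:R :> rat.
      by rewrite [n%:R]pmulrn -en rmorphD /= -pmulrn.
    by congr (v k (_ / _)); ring.
  exists (fun=> 0) => f /andP[f0 f1]; rewrite big1 => [|j _]; last by rewrite mul0r.
  apply/eqP/negPn/negP => /vs[]; rewrite normrM normfV [`|a%:R|]gtr0_norm//.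
  rewrite ler_pdivrMr// ler_norml => /andP[h1 h2] _; case/negP: zc.
  have cE : c%:R = B%:R * a%:R + 1 :> rat by rewrite /c -natr1 natrM mulrC.
  have cZ : (c%:Z)%:~R = c%:R :> rat by rewrite -pmulrn.
  rewrite -(ler_int rat) -(ltr_int rat) rmorphN /= cZ cE.
  by apply/andP; split; lra.
have lin_span y (z : int) : tspan a v y -> lin (fun f => y ((f + z%:~R) / a%:R)).
  move=> [l yl].
  have -> : (fun f => y ((f + z%:~R) / a%:R)) =
      fun f => \sum_(e <- l) e.1.1 * v e.2 ((f + (z - e.1.2)%:~R) / a%:R).
    apply: funext => f; rewrite yl; apply: eq_bigr => e _; congr (_ * v _ _).
    by rewrite rmorphB /=; ring.
  elim: l {yl} => [|e l IH]; first by under eq_fun => f do rewrite big_nil.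
  by under eq_fun => f do rewrite big_cons; apply: linD => //; apply: linZ.
have /choice [P PP] : forall n : nat, exists P : J -> K, forall f, 0 <= f < 1 ->
    x ((n%:R + f - b%:R) / a%:R) = \sum_j P j * h j f.
  move=> n; have [P PP] := lin_span x (n%:Z - b%:Z) xv.
  exists P => f f01; rewrite -PP//; congr (x (_ / _)).
  by rewrite rmorphB /= -!pmulrn; ring.
have /choice [M MP] : forall dj : 'I_p * J, exists P : J -> K, forall f, 0 <= f < 1 ->
    h dj.2 (((dj.1 : nat)%:R + f) / p%:R) ^+ p = \sum_j P j * h j f.
  move=> [d [k n]].
  (* The integer is p times the argument (d + f)/p + n - c, less f. *)
  have [P' PP'] := lin_span _ (d%:Z + n%:Z * p%:Z - c%:Z * p%:Z) (vF k).
  exists P' => f f01; rewrite -PP'// /Frob /h /=; congr (v k _ ^+ _).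
  rewrite !rmorphB !rmorphD !rmorphM /= -!pmulrn; field.
  by rewrite pQ_neq0 aN0.
apply: (@automatic_of_family J h (fun d j => M (d, j)) N P).
- by move=> d j f f01; apply: (MP (d, j)).
- by move=> n f f01; apply: PP.
move=> i /xsupp[]; have -> : a%:R * ((i - b%:R) / a%:R) + b%:R = i by field.
by [].
Qed.

End FrobeniusFiniteAutomatic.

(** * From modules to algebraicity *)

Section PolyAction.
Variable K : closedFieldType.
Implicit Types (c d : {poly K}) (u v : rat -> K).

(** Action of K[t] on arbitrary functions, since generators of the modules may fail to be Hahn
    series; on Hahn series it is the product, by [polyser_mulE]. *)
Definition pact c v : rat -> K := fun i => \sum_(m < size c) c`_m * v (i - m%:R).

Lemma pact_widen n c v i : (size c <= n)%N ->
  pact c v i = \sum_(m < n) c`_m * v (i - m%:R).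
Proof.
move=> cn; rewrite /pact (big_ord_widen n (fun m => c`_m * v (i - m%:R)))//.
rewrite big_mkcond; apply: eq_bigr => m _; case: ltnP => // mc.
by rewrite nth_default ?mul0r.
Qed.

Lemma pactD c d v i : pact (c + d) v i = pact c v i + pact d v i.
Proof.
pose n := maxn (size c) (size d).
rewrite !(@pact_widen n) ?leq_maxl ?leq_maxr ?size_polyD// -big_split.
by apply: eq_bigr => m _; rewrite coefD mulrDl.
Qed.

Lemma pact0 v i : pact 0 v i = 0.
Proof. by rewrite /pact size_poly0 big_ord0. Qed.

Lemma pact_sum I (r : seq I) P (F : I -> {poly K}) v i :
  pact (\sum_(j <- r | P j) F j) v i = \sum_(j <- r | P j) pact (F j) v i.
Proof.
by apply: (big_morph (fun c => pact c v i)) => [c d|]; [apply: pactD|apply: pact0].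
Qed.

Lemma pactZ r c v i : pact (r *: c) v i = r * pact c v i.
Proof.
rewrite !(@pact_widen (size c)) ?size_scale_leq// mulr_sumr.
by apply: eq_bigr => m _; rewrite coefZ mulrA.
Qed.

Lemma pactX c v i : pact (c * 'X) v i = pact c v (i - 1).
Proof.
have [->|c0] := eqVneq c 0; first by rewrite mul0r !pact0.
rewrite /pact size_mulX// big_ord_recl coefMX eqxx mul0r add0r.
apply: eq_bigr => m _; rewrite coefMX /= /bump /=; congr (_ * v _).
by rewrite -natr1; ring.
Qed.

Lemma pactXn c n v i : pact (c * 'X^n) v i = pact c v (i - n%:R).
Proof.
elim: n i => [|n IH] i; first by rewrite expr0 mulr1 subr0.
by rewrite exprSr mulrA pactX IH; congr (pact _ _ _); rewrite -natr1; ring.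
Qed.

Lemma pactC r v i : pact r%:P v i = r * v i.
Proof.
rewrite (@pact_widen 1) ?size_polyC; last by case: eqP.
by rewrite big_ord1 coefC eqxx subr0.
Qed.

Lemma pact1 v i : pact 1 v i = v i.
Proof. by rewrite -polyC1 pactC mul1r. Qed.

Lemma pactM c d v i : pact (c * d) v i = pact c (pact d v) i.
Proof.
elim/poly_ind: c i => [|c r IH] i; first by rewrite mul0r !pact0.
rewrite mulrDl mulrAC !pactD !pactX IH; congr (_ + _).
by rewrite mul_polyC pactZ pactC.
Qed.

Lemma pact_fsum I (r : seq I) c (F : I -> rat -> K) i :
  pact c (fun i => \sum_(j <- r) F j i) i = \sum_(j <- r) pact c (F j) i.
Proof.
rewrite /pact exchange_big; apply: eq_bigr => m _; by rewrite mulr_sumr.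
Qed.

Lemma polyser_mulE c (x : hser K) i : (polyser c * x) i = pact c x i.
Proof.
rewrite (@polyserE _ c (size c))// mulr_suml hco_sum.
by apply: eq_bigr => m _; rewrite mono_mulE.
Qed.

Section FrobeniusIntegral.
Variable p : nat.
Hypothesis charK : p \in [pchar K].

Section Relation.
Variables (I : finType) (a : nat) (v : I -> rat -> K).
Hypothesis a_gt0 : (0 < a)%N.
Let J : finType := (I * 'I_a)%type.
Let u (k : J) : rat -> K := fun i => v k.1 (i - k.2%:R / a%:R).

(** Multiplying by t^E makes all translations z/a nonnegative. Euclidean division by [a] then splits
    each into a power of t and one of the finitely many generators [u]. *)
Lemma tspan_poly y : tspan a v y -> exists E0, forall E, (E0 <= E)%N ->
  exists C : J -> {poly K}, forall i, y (i - E%:R) = \sum_k pact (C k) (u k) i.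
Proof.
have aN0 : (a%:R : rat) != 0 by rewrite pnatr_eq0 -lt0n.
case=> l yl; exists (\sum_(e <- l) absz e.1.2)%N => E El.
pose f l i := \sum_(e <- l) e.1.1 * v e.2 (i - E%:R - e.1.2%:~R / a%:R).
suff [C CP] : exists C : J -> {poly K}, forall i, f l i = \sum_k pact (C k) (u k) i.
  by exists C => i; rewrite -CP; apply: yl.
elim: l {y yl} El => [|[[c z] k] l IH] El.
  exists (fun=> 0) => i; rewrite /f big_nil big1// => j _; exact: pact0.
rewrite big_cons /= in El.
have [|C CP] := IH; first by apply: leq_trans El; apply: leq_addl.
have [n en] : exists n : nat, z + (E * a)%:Z = n%:Z.
  have zE : (absz z <= E * a)%N.
    by apply: leq_trans (leq_pmulr _ a_gt0); apply: leq_trans El; apply: leq_addr.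
  by exists (absz (z + (E * a)%:Z)); lia.
have na : (n %% a < a)%N by rewrite ltn_mod.
pose k0 : J := (k, Ordinal na).
exists (fun j => (if j == k0 then c *: 'X^(n %/ a) else 0) + C j) => i.
rewrite /f big_cons /= -/(f l i) CP (eq_bigr _ (fun j _ => pactD _ _ _ _)) big_split /=.
congr (_ + _); rewrite (bigD1 k0)//= eqxx big1 ?addr0 => [|j /negPf->]; last exact: pact0.
rewrite -['X^_]mul1r pactZ pactXn pact1 /u /=; congr (_ * v k _).
have ez : z%:~R = n%:R - E%:R * a%:R :> rat.
  rewrite [n%:R]pmulrn -en rmorphD /= -pmulrn natrM; ring.
by rewrite ez {1}(divn_eq n a) natrD natrM; field.
Qed.

Lemma frobenius_relation (y : nat -> rat -> K) : (forall j, tspan a v (y j)) ->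
  exists n (w : nat -> {poly K}), (exists2 j, (j <= n)%N & w j != 0) /\
    forall i, \sum_(j < n.+1) pact (w j) (y j) i = 0.
Proof.
move=> yv; pose n := #|J|.
(* One shift [E] for all the functions involved, so that it factors out of the relation and is
   undone by [i']. *)
have [E EP] : exists E, forall j, (j < n.+1)%N -> exists C : J -> {poly K},
    forall i, y j (i - E%:R) = \sum_k pact (C k) (u k) i.
  have /choice [E0 E0P] := fun j => tspan_poly (yv j).
  exists (\sum_(j < n.+1) E0 j)%N => j jn; apply: E0P.
  by rewrite (bigD1 (Ordinal jn))//= leq_addr.
have /choice [C CP] : forall j : 'I_n.+1, exists C : J -> {poly K},
    forall i, y j (i - E%:R) = \sum_k pact (C k) (u k) i.
  by move=> j; apply: EP.
pose D (t : 'I_n.+1) (k : nat) := if insub k is Some k' then C t (enum_val (k' :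
    'I_n)) else 0.
have [||||||w [_ _ [t wt] wD]] := @elimination {poly K} (fun=> True) _ n [set:
    'I_n.+1] D => //.
  by rewrite cardsT card_ord.
exists n, (fun j => if insub j is Some t then w t else 0); split.
  by exists t; [rewrite -ltnS|rewrite valK].
move=> i; pose i' := i + E%:R.
transitivity (\sum_(j < n.+1) \sum_k pact (w j * C j k) (u k) i').
  apply: eq_bigr => j _; rewrite valK.
  transitivity (pact (w j) (fun i => y j (i - E%:R)) i').
    by apply: eq_bigr => m _; congr (_ * y j _); rewrite /i'; ring.
  have -> : (fun i => y j (i - E%:R)) = fun i => \sum_k pact (C j k) (u k) i.
    by apply: funext => q; apply: CP.
  by rewrite pact_fsum; apply: eq_bigr => k _; rewrite pactM.
rewrite exchange_big big1// => k _; rewrite -pact_sum.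
have := wD (enum_rank k) (ltn_ord _).
under eq_bigr => j _ do rewrite /D valK enum_rankK.
by move=> ->; apply: pact0.
Qed.
End Relation.

Lemma frobenius_integral (x : hser K) (I : finType) a (v : I -> rat -> K) :
  (0 < a)%N -> (forall k, tspan a v (Frob p (v k))) -> tspan a v x ->
  integral_over (@Kt K) x.
Proof.
move=> a0 vF xv.
have xjv j : tspan a v (x ^+ (p ^ j)).
  elim: j => [|j IH]; first by rewrite expr1.
  rewrite expnSr exprM -(Frob_hser charK).
  exact: tspan_trans vF (tspan_Frob charK IH).
have [n [w [wn wE]]] := frobenius_relation a0 xjv.
apply: (additive_integral charK wn); apply: hserP => i.
rewrite hco_sum hco0; etransitivity; last exact: wE i.
by apply: eq_bigr => j _; rewrite polyser_mulE.
Qed.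
End FrobeniusIntegral.
End PolyAction.

(** * From automata to modules *)

Section AutomaticFrobenius.
Variable K : closedFieldType.
Variable p : nat.
Hypothesis charK : p \in [pchar K].
Let p_pr := pcharf_prime charK.
Let p_gt0 := prime_gt0 p_pr.
Let p_gt1 := prime_gt1 p_pr.
Let pQ_gt0 : 0 < (p%:R : rat). Proof. by rewrite ltr0n. Qed.
Let pQ_neq0 : (p%:R : rat) != 0. Proof. by rewrite gt_eqF. Qed.
Implicit Types (x y z : rat -> K) (a b : nat).

Lemma twisted_linear_form m (g : 'rV[K]_m -> K) l :
  (forall u v, g (u + v) = g u + g v) -> (forall r v, g (r *: v) = r ^+ l * g v) ->
  forall v, g v = \sum_i v 0 i ^+ l * g (delta_mx 0 i).
Proof.
move=> gD gZ v; have g0 : g 0 = 0.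
  by apply: (addrI (g 0)); rewrite -gD !addr0.
rewrite {1}(row_sum_delta v) (big_morph g gD g0).
by apply: eq_bigr => i _; rewrite gZ.
Qed.

Lemma composed_frob m (tau : 'I_p -> 'rV[K]_m -> 'rV[K]_m) :
  (forall d, @Defs.semilinear K m (@frob K p) (tau d)) -> forall s,
  (forall u v, composed tau s (u + v) = composed tau s u + composed tau s v) /\
  (forall r v, composed tau s (r *: v) = r ^+ (p ^ size s) *: composed tau s v).
Proof.
move=> tauP; elim=> [|d s [IHD IHZ]]; first by split.
split=> [u v|r v] /=; first by rewrite IHD (tauP d).1.
by rewrite IHZ (tauP d).2 /frob -exprM -expnSr.
Qed.

Lemma tspan_rescale I a b (w : I -> rat -> K) y : (0 < a)%N -> tspan 1 w y ->
  tspan a (fun k i => w k (a%:R * i)) (fun i => y (a%:R * i + b%:R)).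
Proof.
move=> a0 [l yl]; exists [seq (e.1.1, e.1.2 - b%:Z, e.2) | e <- l] => i.
rewrite yl big_map; apply: eq_bigr => e _ /=; congr (_ * w _ _).
by rewrite rmorphB /= -pmulrn divr1; field; rewrite pnatr_eq0 -lt0n.
Qed.

(** The generators are the p^l-th powers of the coordinates of the state [vf f], extended by zero
    outside [0,1), and a delta function. An integer word of length l acts p^l-semilinearly, so
    x_{n+f} is a combination of generators of layer l. *)
Lemma automatic_tspan x (N : nat) : p_automatic p x ->
  (forall i, x i != 0 -> i < N%:R) ->
  exists (I : finType) (w : I -> rat -> K),
    (forall k, tspan 1 w (Frob p (w k))) /\ tspan 1 w x.
Proof.
case=> xs [m [iota [pi [tau1 [tau2 [frobinv [[fiK Kfi] _ [piL _] [t1 t2] xE]]]]]]] xN.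
pose D f := 0 <= f < 1 /\ padic p f.
have /choice [wd wdP] : forall f, exists s, D f -> Lp0 (rev s) /\ @fval p s = f.
  move=> f; have [[f01 fp]|nD] := pselect (D f); last by exists [::].
  by have [s sP] := fval_surj p_gt1 f01 fp; exists s.
have /choice [wn wnP] : forall n, exists s, Lp0 s /\ @ival p s = n.
  by move=> n; apply: ival_surj.
pose vf f := composed tau2 (wd f) (iota 1).
have D_digit (d : 'I_p) f : D f -> D (((d : nat)%:R + f) / p%:R).
  move=> [/andP[f0 f1] [k fk]]; split.
    have : ((d : nat).+1%:R : rat) <= p%:R by rewrite ler_nat.
    rewrite -natr1 => dp; rewrite divr_ge0 ?addr_ge0//=.
    by rewrite ltr_pdivrMr// mul1r; lra.
  exists k.+1; rewrite expnS natrM mulrA mulfVK// mulrDl rpredD// -natrM.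
  exact: rpred_nat.
(* For d = 0 and f = 0 the word [d :: wd f] would have a trailing zero, so the recursion can fail
   there; the generator [None] repairs this. *)
have vfS (d : 'I_p) f : D f -> (d != 0%N :> nat) || (f != 0) ->
    vf (((d : nat)%:R + f) / p%:R) = tau2 d (vf f).
  move=> Df df; rewrite /vf; have [sv sf] := wdP _ Df.
  have [tv tf] := wdP _ (D_digit d f Df).
  suff -> : wd (((d : nat)%:R + f) / p%:R) = d :: wd f by [].
  apply: (fval_inj p_gt1) => //; last by rewrite tf /= sf.
  rewrite Lp0_rev_cons; case: (wd f) sv sf => //= _ f0.
  by move: df; rewrite -f0 eqxx orbF.
have inI (d e : 'I_p) f : D f -> D ((d : nat)%:R + f - (e : nat)%:R) -> e = d.
  move=> [/andP[f0 f1] _] [/andP[g0 g1] _]; apply: val_inj => /=.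
  by apply: natr_inj_lt1; lra.
have D0 : D 0 by split; [rewrite lexx ltr01|exists 0%N; rewrite mul0r].
pose L := N.+1.
pose I : finType := option ('I_m * 'I_L).
pose w (k : I) f := if k is Some (i, l) then (if `[< D f >] then vf f 0 i ^+ (p ^ l)
    else 0)
  else (f == 0)%:R.
have wND k f : ~ D f -> w (Some k) f = 0.
  by move=> nD; rewrite /w; case: k => i l; case: asboolP.
have wD i l f : D f -> w (Some (i, l)) f = vf f 0 i ^+ (p ^ l).
  by move=> Df; rewrite /w; case: asboolP.
have wNone f : w None f = (f == 0)%:R by [].
clearbody w.
pose T d i k := tau2 d (delta_mx 0 k) 0 i.
have tau2E d v i : tau2 d v 0 i = \sum_k frobinv (v 0 k) * T d i k.
  have tau20 : tau2 d 0 = 0 by apply: (addrI (tau2 d 0)); rewrite -(t2 d).1 !addr0.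
  rewrite {1}(row_sum_delta v) (big_morph (tau2 d) (t2 d).1 tau20) summxE.
  by apply: eq_bigr => k _; rewrite (t2 d).2 mxE.
pose d0 : 'I_p := Ordinal p_gt0.
(* Frobenius raises the power to p^(l+1) and the inverse-Frobenius semilinearity of [tau2] brings it
   back to p^l, so each layer is stable up to the defect [e] at 0. For g nonzero only the digit d
   with g - d in [0,1) contributes. *)
have FwE i l : exists e, forall g, Frob p (w (Some (i, l))) g =
    \sum_(d : 'I_p) \sum_k T d i k ^+ (p ^ l.+1) *
      w (Some (k, l)) (g - (d%:Z)%:~R / 1%:R) + e * w None g.
  exists (w (Some (i, l)) 0 ^+ p - \sum_k T d0 i k ^+ (p ^ l.+1) * w (Some (k, l)) 0)
      => g.
  under eq_bigr => d _ do rewrite -pmulrn divr1.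
  have [->|g0] := eqVneq g 0.
    rewrite /Frob mul0r wNone eqxx mulr1 addrC -addrA -[LHS]addr0; congr (_ + _).
    apply/esym/eqP; rewrite addrC subr_eq0; apply/eqP.
    rewrite (bigD1 d0)//= subr0 [X in _ + X]big1 ?addr0// => d dd0.
    apply: big1 => k _; rewrite wND ?mulr0// => -[/andP[h _] _].
    have : (0 < d)%N by rewrite lt0n; move: dd0; rewrite -val_eqE.
    by rewrite -(ltr_nat rat); lra.
  rewrite wNone (negPf g0) mulr0 addr0.
  have [Dgp|nDgp] := pselect (D (g / p%:R)); last first.
    rewrite /Frob wND// expr0n gtn_eqF// big1// => d _; apply: big1 => k _.
    rewrite wND ?mulr0// => Dgd; apply: nDgp.
    by have := D_digit d _ Dgd; rewrite addrC subrK.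
  have [/andP[gp0 gp1] [k gk]] := Dgp.
  have g_ge0 : 0 <= g by move: gp0; rewrite pmulr_lge0 ?invr_gt0.
  have glp : g < p%:R by move: gp1; rewrite ltr_pdivrMr// mul1r.
  pose n := Num.truncn g.
  have /andP[n1 n2] : n%:R <= g < n.+1%:R by apply: truncn_itv.
  have np : (n < p)%N by rewrite -(ltr_nat rat); apply: le_lt_trans glp.
  pose d : 'I_p := Ordinal np; pose f := g - n%:R.
  have gE : g = (d : nat)%:R + f by rewrite /f /=; ring.
  have Df : D f.
    split; first by apply/andP; split; rewrite /f; [lra|move: n2; rewrite -natr1; lra].
    exists k; rewrite /f mulrBl rpredB//; last by rewrite rpredM ?rpred_nat.
    by rewrite -[g](divfK pQ_neq0) mulrAC rpredM// rpred_nat.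
  rewrite /Frob wD// {1}gE vfS//; last first.
    by move: g0; rewrite gE; apply: contraNT; rewrite negb_or !negbK => /andP[/eqP->
        /eqP->].
  rewrite tau2E (bigD1 d)//= [X in _ + X]big1 ?addr0 => [|e ed].
    rewrite -exprM -expnSr (pchar_exp_sum charK); apply: eq_bigr => q _.
    rewrite exprMn expnS exprM -{1}[frobinv _ ^+ p]/(frob p (frobinv _)) fiK mulrC.
    by congr (_ * _); rewrite -[in RHS]/(f) wD.
  apply: big1 => q _; rewrite wND ?mulr0// gE => /(inI d e f Df) h.
  by rewrite h eqxx in ed.
have shift1 k d : tspan 1 w (fun g => w k (g - (d%:Z)%:~R / 1%:R)).
  exact/tspan_shift/tspan_gen.
exists I, w; split.
  case=> [[i l]|].
    have [e eE] := FwE i l.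
    have -> : Frob p (w (Some (i, l))) = fun g => \sum_(d : 'I_p)
        \sum_k T d i k ^+ (p ^ l.+1) *
      w (Some (k, l)) (g - (d%:Z)%:~R / 1%:R) + e * w None g by apply: funext.
    apply: tspanD; last exact/tspanZ/tspan_gen.
    apply: tspan_sum => d; apply: tspan_sum => k; apply: tspanZ; exact: shift1.
  have -> : Frob p (w None) = w None; last exact: tspan_gen.
  apply: funext => g; rewrite /Frob !wNone mulf_eq0 invr_eq0 (negPf pQ_neq0) orbF.
  by case: (g == 0); rewrite ?expr1n// expr0n gtn_eqF.
(* The contribution of the integer part [n] on a basis state; the layer to use, [ln n], is the
   number of digits of [n]. *)
pose c n i := pi (composed tau1 (rev (wn n)) (delta_mx 0 i)).
pose ln n : 'I_L := inord (size (wn n)).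
suff -> : x = fun g => \sum_(n < N) \sum_i c n i *
    w (Some (i, ln n)) (g - (n%:Z)%:~R / 1%:R).
  by apply: tspan_sum => n; apply: tspan_sum => i; apply: tspanZ; apply: shift1.
apply: funext => g; under eq_bigr => n _ do rewrite -pmulrn divr1.
have [[g0 gp gN]|no] := pselect [/\ 0 <= g, padic p g & g < N%:R]; last first.
  rewrite big1 => [|n _].
    apply/eqP/negPn/negP => xg; apply: no.
    by have /ZpinvNonnegP[g0 gp] := xs _ xg; split=> //; apply: xN.
  apply: big1 => i _; rewrite wND ?mulr0// => -[/andP[f0 f1] [k fk]]; apply: no.
  have nN : ((n : nat).+1%:R : rat) <= N%:R by rewrite ler_nat.
  have n0 : 0 <= ((n : nat)%:R : rat) by [].
  move: nN; rewrite -natr1 => nN; split; [lra| |lra].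
  exists k; rewrite -[g](subrK (n : nat)%:R) mulrDl rpredD// -natrM.
  exact: rpred_nat.
pose n := Num.truncn g.
have /andP[n1 n2] : n%:R <= g < n.+1%:R by apply: truncn_itv.
have nN : (n < N)%N by rewrite -(ltr_nat rat); apply: le_lt_trans gN.
pose f := g - n%:R.
have Df : D f.
  split; first by apply/andP; split; rewrite /f; [lra|move: n2; rewrite -natr1; lra].
  have [k gk] := gp; exists k; rewrite /f mulrBl rpredB//.
  by rewrite rpredM ?rpred_nat.
rewrite (bigD1 (Ordinal nN))//= [X in _ + X]big1 ?addr0 => [|n' nn'].
  have [sv sf] := wdP _ Df; have [tv tn] := wnP n.
  have -> : x g = x (Lval (wn n, wd f)).
    by rewrite LvalE /= sf tn; congr x; rewrite /f; ring.
  rewrite xE; last by rewrite /Lp /= tv sv.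
  have [cD cZ] := composed_frob t1 (rev (wn n)).
  have piD u v : pi (u + v) = pi u + pi v by have := piL 1 u v; rewrite scale1r mul1r.
  have pi0 : pi 0 = 0 by apply: (addrI (pi 0)); rewrite -piD !addr0.
  have piZ r u : pi (r *: u) = r * pi u by rewrite -[_ *: u]addr0 piL pi0 addr0.
  rewrite (@twisted_linear_form _ (fun v => pi (composed tau1 (rev (wn n)) v))
      (p ^ size (wn n))).
  - apply: eq_bigr => i _; rewrite -/f wD// mulrC /ln inordK//.
    by rewrite ltnS (leq_trans (size_ival p_gt1 tv))// tn ltnW.
  - by move=> u v; rewrite cD piD.
  - by move=> r v; rewrite cZ piZ size_rev.
apply: big1 => i _; rewrite wND ?mulr0// => -[/andP[f0 f1] _].
move: nn'; rewrite -val_eqE /= => /eqP; apply.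
by move: n2; rewrite -natr1 => n2; apply: natr_inj_lt1; rewrite -/n; lra.
Qed.

(** The bound [u] leaves finitely many integer parts. Substituting [a * i] for the exponent turns
    integral translations into translations by multiples of 1/a and commutes with [Frob]. *)
Lemma quasi_automatic_integral (x : hser K) u : p_quasi_automatic p x ->
  (forall i, x i != 0 -> i <= u) -> integral_over (@Kt K) x.
Proof.
case=> a [b [a0 [_ xa]]] xu.
have a0R : 0 < (a%:R : rat) by rewrite ltr0n.
pose N := Num.bound `|a%:R * u + b%:R|.
have [|I [w [wF xw]]] := automatic_tspan (N := N) xa.
  move=> j /xu; rewrite ler_pdivrMr// => ju.
  apply: le_lt_trans (archi_boundP (normr_ge0 _)); apply: le_trans (ler_norm _).
  lra.
apply: (frobenius_integral charK (v := fun k i => w k (a%:R * i)) a0) => [k|].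
  have := tspan_rescale 0 a0 (wF k).
  rewrite /Frob; congr (tspan _ _ _); apply: funext => i.
  by rewrite addr0 mulrA.
have := tspan_rescale b a0 xw; congr (tspan _ _ _); apply: funext => i.
by rewrite addrK mulrC mulKf// gt_eqF.
Qed.

End AutomaticFrobenius.

(** * Passage to the closure *)

Section Closure.
Variables (R : realType) (p : nat) (K : closedFieldType).
Hypothesis charK : p \in [pchar K].
Implicit Types x : rat -> K.

Lemma trunc_cut (r : R) : cut (fun i => ratr i < r).
Proof.
split=> [i j ij|]; first by apply: le_lt_trans; rewrite ler_rat.
exists (Num.bound `|r|)%:R => i ir; rewrite -(ler_rat R) ratr_nat.
exact/ltW/(lt_trans ir)/(le_lt_trans (ler_norm _))/archi_boundP.
Qed.

Lemma integral_Kt_Klaurent x : integral_over (@Kt K) x -> integral_over (@Klaurent K) x.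
Proof.
case=> hx [n [a [aP aE]]]; split=> //; exists n, a; split=> // k.
have [ha ka] := aP k; split=> //.
exact: (Kt_laurent (x := Hser ha)).
Qed.

Lemma tclosure_mono (S T : (rat -> K) -> Prop) x : (forall y, S y -> T y) ->
  tclosure S x -> tclosure T x.
Proof.
move=> ST [hx xS]; split=> // r; have [y [hy [Sy xy]]] := xS r.
by exists y; split=> //; split=> //; apply: ST.
Qed.

Lemma closure_quasi_automatic x : tclosure (integral_over (@Klaurent K)) x ->
  hahn x /\ forall r : R, p_quasi_automatic p (trunc x r).
Proof.
move=> [hx xS]; split=> // r; have cr := trunc_cut r; have [_ [u ru]] := cr.
(* Up to a rational upper bound [u] of the cut, [x] agrees with an integral series [y], so both have
   the same truncation at [r]. *)
have [y [hy [Sy xy]]] := xS u.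
apply: (frobenius_finite_automatic charK).
have -> : trunc x r = restr (fun i => ratr i < r) (Hser hy).
  by apply: funext => i; rewrite /trunc /restr; case: ifP => // /ru /xy.
exact: (tame_cuts_integral charK (x := Hser hy)).
Qed.

Lemma quasi_automatic_closure x :
  hahn x -> (forall r : R, p_quasi_automatic p (trunc x r)) ->
  tclosure (integral_over (@Kt K)) x.
Proof.
move=> hx xq; split=> // r.
(* Truncation is strict whereas the closure asks for agreement at [r] itself, hence r + 1. *)
pose C i := ratr i < (ratr (r + 1) : R).
pose y := hrestr C (Hser hx).
exists y; split; first exact: hcoP; split.
  apply: (quasi_automatic_integral charK (u := r + 1)) => [|i].
    exact: (xq (ratr (r + 1))).
  by rewrite hrestrE /C ltr_rat; case: ifP => [/ltW//|]; rewrite eqxx.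
move=> i ir; rewrite /y hrestrE /C ltr_rat.
by have -> : i < r + 1 by lra.
Qed.

End Closure.

Theorem theorem10p5 (R : realType) (p : nat) (K : closedFieldType) :
  prime p -> p \in [pchar K] ->
  (forall x : rat -> K,
     tclosure (integral_over (Kt (K:=K))) x <->
     tclosure (integral_over (Klaurent (K:=K))) x) /\
  (forall x : rat -> K,
     tclosure (integral_over (Kt (K:=K))) x <->
     (hahn x /\ forall r : R, p_quasi_automatic p (trunc x r))).
Proof.
move=> _ charK.
have up x : tclosure (integral_over (Kt (K:=K))) x ->
    tclosure (integral_over (Klaurent (K:=K))) x.
  exact/tclosure_mono/integral_Kt_Klaurent.
split=> x; split.
- exact: up.
(* The nontrivial inclusion between the two closures passes through automata: truncations of a limit
   of series integral over K((t)) are quasi-automatic, hence integral over K(t). *)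
- move=> /(closure_quasi_automatic R charK)[hx xq].
  exact: (quasi_automatic_closure charK hx xq).
- by move=> /up; apply: closure_quasi_automatic.
- by move=> [hx xq]; exact: (quasi_automatic_closure charK hx xq).
Qed.
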